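(* Let $n,m\in\mathbb N$, let $X\in U_{m,n}(\mathbb C)$ and $Y\in M_{m,n}(\mathbb C)$, and suppose that $\mathfrak m'=\mathrm{Span}_{\mathbb R}\{\hat X,\hat Y\}$ is a 2-dimensional subspace of $\mathfrak m\subset\mathfrak u(n,m)$ and that $$X^*X=\lambda I_n,\qquad X^*Y=\mu I_n,\qquad \mu\in\mathbb C.$$ Then $\mathfrak m'$ gives rise to a complete totally geodesic surface $S$ in $D_{n,m}$ if and only if either ($\mathrm{Im}\,\mu\neq0$ and $iX\in\mathrm{Span}_{\mathbb R}\{X,Y\}$) or ($\mathrm{Im}\,\mu=0$ and $Y\in U_{m,n}(\mathbb C)$) holds.
   Context: Let $\Lambda^n_m=\begin{pmatrix}-I_n&0\\ 0&I_m\end{pmatrix}$ and $U(n,m)=\{\Phi\in GL_{n+m}(\mathbb C):\Phi^*\Lambda^n_m\Phi=\Lambda^n_m\}$, with Lie algebra $\mathfrak u(n,m)$. $U(n)\times U(m)\subset U(n,m)$ is the block-diagonal subgroup, and $D_{n,m}=U(n,m)/(U(n)\times U(m))$ with origin $o$ (the identity coset), regarded as an affine symmetric space. Canonical decomposition: $\mathfrak u(n,m)=\mathfrak h+\mathfrak m$ with $\mathfrak h=\mathfrak u(n)+\mathfrak u(m)$ (block-diagonal) and $\mathfrak m=\{\hat X: X\in M_{m,n}(\mathbb C)\}$, where $\hat X=\begin{pmatrix}0&X^*\\ X&0\end{pmatrix}$; $\mathfrak m$ is identified with $T_oD_{n,m}$. $U_{m,n}(\mathbb C)=\{X\in M_{m,n}(\mathbb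 C): X^*X=\lambda I_n\text{ for some }\lambda\in\mathbb C\setminus\{0\}\}$ (then necessarily $\lambda>0$). A linear subspace $\mathfrak m'\subset\mathfrak m$ ''gives rise to'' a complete totally geodesic submanifold $S$ if there is a complete totally geodesic submanifold of $D_{n,m}$ through $o$ with tangent space $\mathfrak m'$ at $o$; $S$ is this submanifold or a translate of it by an element of $U(n,m)$. *)

(* Defs.v *)
From mathcomp Require Import all_boot all_order all_algebra.
From mathcomp Require Import all_classical all_reals all_analysis.
From mathcomp Require Export complex.

Set Implicit Arguments.
Unset Strict Implicit.
Unset Printing Implicit Defensive.

Import Order.TTheory GRing.Theory Num.Theory numFieldNormedType.Exports.

Local Open Scope classical_set_scope.
Local Open Scope ring_scope.
Local Open Scope complex_scope.
Local Open Scope sesquilinear_scope.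

Definition real_span (R : realType) (V : lmodType R[i]) (s : seq V) : set V :=
  [set v | exists a : 'I_(size s) -> R, v = \sum_i (a i)%:C *: s`_i].

Definition real_free (R : realType) (V : lmodType R[i]) (s : seq V) : Prop :=
  forall a : 'I_(size s) -> R,
    \sum_i (a i)%:C *: s`_i = 0 -> forall i, a i = 0.

Definition has_real_dim (R : realType) (V : lmodType R[i]) (d : nat)
    (E : set V) : Prop :=
  exists s : seq V, [/\ size s = d, real_free s & E = real_span s].

(* For V finite-dimensional and U open, C^k with all directional derivatives
   is the usual C^k. *)
Fixpoint Ck (R : realType) (V : normedModType R) (k : nat) (U : set V)
    (f : V -> R^o) : Prop :=
  (forall x, U x -> {for x, continuous f}) /\
  match k with
  | 0 => True
  | k'.+1 => forall v : V,
      (forall x, U x -> derivable f x v) /\ Ck k' U (fun x => 'D_v f x)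
  end.

Definition smooth_mx (R : realType) (V : normedModType R) (p q : nat)
    (U : set V) (f : V -> 'M[R[i]]_(p, q)) : Prop :=
  forall i j k, Ck k U (fun x => complex.Re (f x i j)) /\
                Ck k U (fun x => complex.Im (f x i j)).

Definition mx_derive (R : realType) (V : normedModType R) (p q : nat)
    (f : V -> 'M[R[i]]_(p, q)) (v x : V) : 'M[R[i]]_(p, q) :=
  \matrix_(i, j) ('D_v (fun y => complex.Re (f y i j) : R^o) x
                  +i* 'D_v (fun y => complex.Im (f y i j) : R^o) x).

Section SymmetricSpace.
Variables (R : realType) (n m : nat).
Notation mat := 'M[R[i]]_(n + m).

Definition Lambda : mat := block_mx (- 1%:M) 0 0 1%:M.

Definition Unm : set mat :=
  [set g | g \in unitmx /\ g ^t* *m Lambda *m g = Lambda].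

Definition UnUm : set mat :=
  [set k | exists (A : 'M[R[i]]_n) (B : 'M[R[i]]_m),
     [/\ A \is unitarymx, B \is unitarymx & k = block_mx A 0 0 B]].

(* Points of D_{n,m} are left cosets, as sets of matrices. *)
Definition coset (g : mat) : set mat := [set g *m k | k in UnUm].

Definition D : set (set mat) := [set coset g | g in Unm].

Definition origin : set mat := coset 1%:M.

Definition translate (h : mat) (S : set (set mat)) : set (set mat) :=
  [set [set h *m g | g in p] | p in S].

(* Quotient topology; U(n,m) has the topology of the real and imaginary parts
   of the entries.  Only the trace of W on D matters. *)
Definition openD (W : set (set mat)) : Prop :=
  exists2 O : set ('M[R]_(n + m) * 'M[R]_(n + m)), open O &
    forall g, Unm g ->
      (W (coset g) <-> O (map_mx (@complex.Re R) g, map_mx (@complex.Im R) g)).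

Definition connectedD (S : set (set mat)) : Prop :=
  forall W1 W2, openD W1 -> openD W2 ->
    S `<=` W1 `|` W2 -> S `&` (W1 `&` W2) = set0 -> S `<=` W1 \/ S `<=` W2.

(* In the canonical decomposition u(n,m) = h + m, m is the range of [hat]. *)

Definition hat (X : 'M[R[i]]_(m, n)) : mat := block_mx 0 (X ^t*) X 0.

(* Let f take values in U(n,m).  Then Z = f(x)^-1 D_v f(x) lies in u(n,m) and
   its m-component is hat (dlsubmx Z).  The vectors at gK are the classes of
   pairs (g, A), A in M_{m,n}(C), modulo K, with (g, A) tangent at 0 to
   t |-> g exp(t hat A) K; [velocity f v x] is the second component, in the
   frame f(x), of the v-derivative at x of the map y |-> f(y)K into D. *)
Definition velocity (V : normedModType R) (f : V -> mat) (v x : V) :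
    'M[R[i]]_(m, n) :=
  dlsubmx (invmx (f x) *m mx_derive f v x).

(* Geodesic of the canonical connection, presented by a horizontal lift c:
   the lower left block of the Maurer-Cartan form is the velocity, its
   block-diagonal part vanishes (c horizontal), and along c the covariant
   derivative is the ordinary derivative of the velocity, so that the geodesics
   are the t |-> c(t)K with constant velocity A. *)
Definition geodesic_lift (A : 'M[R[i]]_(m, n)) (c : R^o -> mat) : Prop :=
  [/\ forall t, Unm (c t), smooth_mx setT c &
      forall t, mx_derive c 1 t = c t *m hat A].

(* A local parametrization u |-> f(u)K of S: an immersion which is a
   homeomorphism onto a relatively open subset of S. *)
Definition parametrization (d : nat) (S : set (set mat)) (U : set 'rV[R]_d)
    (f : 'rV[R]_d -> mat) : Prop :=
  [/\ [/\ open U, smooth_mx U f & forall u, U u -> Unm (f u)],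
      forall u v, U u -> v != 0 -> velocity f v u != 0,
      forall u v, U u -> U v -> coset (f u) = coset (f v) -> u = v &
      forall U', open U' -> U' `<=` U ->
        exists2 W, openD W & [set coset (f u) | u in U'] = S `&` W].

Definition submanifold (d : nat) (S : set (set mat)) : Prop :=
  [/\ S `<=` D, S !=set0, connectedD S &
      forall p, S p -> exists (U : set 'rV[R]_d) (f : 'rV[R]_d -> mat),
        parametrization S U f /\ exists2 u, U u & p = coset (f u)].

(* The tangent space of S at the point gK, read in the frame g. *)
Definition tangent (S : set (set mat)) (g : mat) : set 'M[R[i]]_(m, n) :=
  [set A | exists (e : R) (c : R^o -> mat),
     [/\ 0 < e, smooth_mx [set t : R^o | `|t| < e] c,
         forall t, `|t| < e -> Unm (c t) /\ S (coset (c t)),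
         c 0 = g & A = velocity c 1 0]].

Definition totally_geodesic (S : set (set mat)) : Prop :=
  forall g A c, Unm g -> S (coset g) -> tangent S g A ->
    geodesic_lift A c -> c 0 = g ->
    exists2 e : R, 0 < e & forall t, `|t| < e -> S (coset (c t)).

(* Used for totally geodesic S, whose own geodesics are the geodesics of
   D_{n,m} contained in S: each of them extends, within S, to the real line. *)
Definition geodesically_complete (S : set (set mat)) : Prop :=
  forall A c (e : R), 0 < e -> geodesic_lift A c ->
    (forall t, `|t| < e -> S (coset (c t))) -> forall t, S (coset (c t)).

Definition complete_totally_geodesic (d : nat) (S : set (set mat)) : Prop :=
  [/\ submanifold d S, totally_geodesic S & geodesically_complete S].

(* The class of (1, A) at the origin corresponds to hat A in m. *)
Definition gives_rise_to (d : nat) (m' : set mat) (S : set (set mat)) : Prop :=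
  exists S0 h,
    [/\ complete_totally_geodesic d S0, S0 origin,
        [set hat A | A in tangent S0 1%:M] = m', Unm h & S = translate h S0].

End SymmetricSpace.

Definition Umn (R : realType) (m n : nat) : set 'M[R[i]]_(m, n) :=
  [set X | exists2 lambda : R[i],
     lambda != 0 & X ^t* *m X = lambda%:M].

(* Main.v *)
Require Import Defs.
From mathcomp Require Import all_boot all_order all_algebra.
From mathcomp Require Import all_classical all_reals all_analysis.
From mathcomp Require Import ring lra.

(** The subspace [m'] is the tangent plane of a complete totally geodesic surface
    exactly when it is a Lie triple system, and for the planes considered here
    being a Lie triple system amounts to the stated alternative.  Both
    implications are obtained from explicit exponentials and from the coordinate
    [c a^-1] of the coset of the matrix with blocks [a], [b], [c], [d].

    Necessity.  Let S be complete and totally geodesic through the origin, with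
    tangent space V there, and let A, B be in V.  All the geodesics [t |-> exp
    (t hat (A + s B)) o] lie in S, so the Jacobi fields [J_A (B) = (sinh (ad A)
    / ad A) B] and their sums with A are tangent to S at [exp (hat A) o].  Going
    back from there along [- (A + s J_A (B))] yields curves in S through the
    origin, whose velocities at [s = 0] are, up to sign, [J_A (J_A (B))].  Hence
    V is stable under [J_A] iterated twice ([tangent_jacobi_twice]).  When the
    Gram matrices of A and B are diagonal, and [A^* B] too, [exp (hat A)] and
    [J_A (B)] have closed forms ([expo], [jacobi]); for the pairs that occur
    below, a unitary change of basis of C^n leads to that situation
    ([diagonalize_gram]).  Replacing Y by [Y' = Y - (Re mu / lambda) X], which
    changes neither the plane nor the alternative, makes [X^* Y'] equal to [i Im
    mu].  If [Im mu] is nonzero, the iterate for [A = X], [B = Y'] is a real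
    combination of [Y'] and of [i X], with a nonzero coefficient at [i X], so [i
    X] is in V ([necessary_complex]).  If [Im mu = 0], a unitary change of basis
    splits [X] and [Y'] into n pairs of orthogonal columns, each spanning a
    hyperbolic plane, and the iterate for [A = X + Y'], [B = X] forces the
    columns of [Y'] to have the same length ([necessary_real]).

    Sufficiency.  In either case the plane has a basis [E1, E2] of isometries
    with [E1^* E2 = i kap], where [kap = 0] or [E2 = i E1].  The points of D
    with [c a^-1] in the plane form the surface: a Poincare disc if [kap = 1], a
    Klein disc if [kap = 0].  It is the image of R^2 under the section [frame],
    and along a geodesic tangent to it [c a^-1 = W + z P] with [W] and [P] in the
    plane, where the scalar z is built from Gram products of the plane and
    therefore stabilizes it ([geodesic_in_surface], [tangent_surface]). *)

Import Order.TTheory GRing.Theory Num.Theory numFieldNormedType.Exports.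
Local Open Scope classical_set_scope.
Local Open Scope ring_scope.
Local Open Scope sesquilinear_scope.

Set Implicit Arguments.
Unset Strict Implicit.
Unset Printing Implicit Defensive.

Local Notation Re := complex.Re.
Local Notation Im := complex.Im.
Local Notation "x %:C" := (real_complex _ x).

(** * Functions of class C^k *)

Section Smooth.
Variables (R : realType) (V : normedModType R).
Implicit Types (U : set V) (f g : V -> R^o) (k : nat).

Lemma Ck_continuous k U f x : Ck k U f -> U x -> {for x, continuous f}.
Proof. by case: k => [|k] [cf _]; apply: cf. Qed.

Lemma Ck_derivable k U f x v : Ck k.+1 U f -> U x -> derivable f x v.
Proof. by case=> _ /(_ v)[df _]; apply: df. Qed.

Lemma Ck_le k U f : Ck k.+1 U f -> Ck k U f.
Proof.
elim: k f => [|k IH] f; first by case=> cf _; split.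
move=> [cf df]; split=> // v; have [dfv Cdf] := df v.
by split=> //; apply: IH.
Qed.

Lemma Ck_ext k U f g : open U -> (forall x, U x -> f x = g x) ->
  Ck k U f -> Ck k U g.
Proof.
move=> oU; elim: k f g => [|k IH] f g fg [cf df].
  split=> // x Ux; have nfg : \near x, f x = g x.
    by apply: filterS (open_nbhs_nbhs (conj oU Ux)) => y /fg.
  rewrite /prop_for /continuous_at -(fg _ Ux).
  exact: cvg_trans (near_eq_cvg nfg) (cf x Ux).
have nfg x : U x -> \near x, f x = g x.
  by move=> Ux; apply: filterS (open_nbhs_nbhs (conj oU Ux)) => y /fg.
split=> [x Ux|v].
  rewrite /prop_for /continuous_at -(fg _ Ux).
  exact: cvg_trans (near_eq_cvg (nfg x Ux)) (cf x Ux).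
have [dfv Cdf] := df v; split=> [x Ux|].
  exact: near_eq_derivable (nfg x Ux) (dfv x Ux).
by apply: IH Cdf => x Ux; apply: near_eq_derive; apply: nfg.
Qed.

Lemma CkS k U f (df : V -> V -> R^o) : open U ->
  (forall x, U x -> {for x, continuous f}) ->
  (forall x v, U x -> is_derive x v f (df v x)) ->
  (forall v, Ck k U (df v)) -> Ck k.+1 U f.
Proof.
move=> oU cf Df Cdf; split=> // v; split=> [x Ux|].
  by have [] := Df x v Ux.
by apply: Ck_ext (Cdf v) => // x Ux; have [_ ->] := Df x v Ux.
Qed.

Lemma Ck_cst k U (c : R^o) : Ck k U (fun=> c).
Proof.
elim: k c => [|k IH] c; first by split=> // x _; apply: cst_continuous.
split=> [x _|v]; first exact: cst_continuous.
split=> [x _|]; first exact: derivable_cst.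
suff -> : (fun x => 'D_v (fun=> c) x) = (fun=> 0) by [].
by apply/funext => x; rewrite derive_cst.
Qed.

Lemma Ck_derive k U f x v : Ck k.+1 U f -> U x -> is_derive x v f ('D_v f x).
Proof. by move=> Cf Ux; apply: derivableP; apply: Ck_derivable Cf Ux. Qed.

Lemma CkD k U f g : open U -> Ck k U f -> Ck k U g ->
  Ck k U (fun x => f x + g x).
Proof.
move=> oU; elim: k f g => [|k IH] f g Cf Cg.
  by split=> // x Ux; apply: continuousD; [move: Cf|move: Cg] => -[+ _]; apply.
apply: (@CkS _ _ _ (fun v x => 'D_v f x + 'D_v g x)) => // [x Ux|x v Ux|v].
- by apply: continuousD; [apply: Ck_continuous Cf Ux|apply: Ck_continuous Cg Ux].
- by apply: is_deriveD; [apply: Ck_derive Cf Ux|apply: Ck_derive Cg Ux].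
- by apply: IH; [case: Cf|case: Cg] => _ /(_ v)[].
Qed.

Lemma CkM k U f g : open U -> Ck k U f -> Ck k U g ->
  Ck k U (fun x => f x * g x).
Proof.
move=> oU; elim: k f g => [|k IH] f g Cf Cg.
  by split=> // x Ux; apply: continuousM; [move: Cf|move: Cg] => -[+ _]; apply.
apply: (@CkS _ _ _ (fun v x => f x * 'D_v g x + g x * 'D_v f x)) => //.
- move=> x Ux.
  by apply: continuousM; [apply: Ck_continuous Cf Ux|apply: Ck_continuous Cg Ux].
- move=> x v Ux.
  by apply: is_deriveM; [apply: Ck_derive Cf Ux|apply: Ck_derive Cg Ux].
- move=> v; apply: CkD => //; apply: IH; try exact: Ck_le.
    by case: Cg => _ /(_ v)[].
  by case: Cf => _ /(_ v)[].
Qed.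

Lemma is_derive_line f x v (d : R) :
  is_derive (0 : R) 1 (fun s : R => f (s *: v + x) : R^o) d -> is_derive x v f d.
Proof.
case=> dl <-; split; first exact/derivable1P.
rewrite /derive; set g1 := fun h => h^-1 *: _; set g2 := fun h => h^-1 *: _.
suff -> : g1 = g2 by []; apply/funext => s; rewrite /g1 /g2 /=.
by rewrite addr0 scale0r add0r [_%:A]mulr1.
Qed.

Lemma is_derive_restrict f x v (d : R) :
  is_derive x v f d -> is_derive (0 : R) 1 (fun s : R => f (s *: v + x) : R^o) d.
Proof.
case=> df <-; have dl := (derivable1P f x v).1 df.
rewrite [X in is_derive _ _ _ X](_ : _ = 'D_1 (fun s : R => f (s *: v + x) : R^o) 0).
  exact: derivableP.
rewrite /derive; set g1 := fun h => h^-1 *: _; set g2 := fun h => h^-1 *: _.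
suff -> : g1 = g2 by []; apply/funext => s; rewrite /g1 /g2 /=.
by rewrite addr0 scale0r add0r [_%:A]mulr1.
Qed.

Lemma is_derive_linear f x v :
  (forall (h : R) y w, f (h *: w + y) = h * f w + f y) -> is_derive x v f (f v).
Proof.
move=> lf; apply: is_derive_line.
have := is_deriveD (is_deriveM (is_derive_id (0 : R) 1) (is_derive_cst (f v) (0 : R) 1))
  (is_derive_cst (f x) (0 : R) 1).
rewrite scale0r add0r addr0 [_ *: 1]mulr1; congr is_derive.
by apply/funext => s; rewrite lf.
Qed.

(** Directional derivatives of [h \o f] only involve the restriction of [f] to
    a line, so the one-variable chain rule suffices. *)
Lemma is_derive_comp (h : R -> R) f x v (dh df : R) :
  is_derive (f x : R) (1 : R) h dh -> is_derive x v f df ->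
  is_derive x v (fun y => h (f y) : R^o) (dh * df).
Proof.
move=> Dh /is_derive_restrict Df; apply: is_derive_line.
by apply: is_derive1_comp; rewrite scale0r add0r.
Qed.

(** The hypothesis on [dh] is only used below order [k], where it may rely on
    the regularity of [h \o f] already obtained: this is what closes the
    induction for exponentials, inverses and square roots, whose derivatives are
    expressed by the functions themselves. *)
Lemma Ck_comp (h : R -> R) (dh : R -> R) k U f : open U ->
  (forall x, U x -> is_derive (f x) 1 h (dh (f x))) ->
  (forall j, (j < k)%N -> Ck j U (fun x => h (f x)) ->
     Ck j U (fun x => dh (f x))) ->
  Ck k U f -> Ck k U (fun x => h (f x)).
Proof.
move=> oU Dh; elim: k => [|k IH] Cdh Cf.
  split=> // x Ux; apply: continuous_comp; first exact: Ck_continuous Cf Ux.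
  apply: differentiable_continuous; apply/derivable1_diffP.
  by have [] := Dh x Ux.
have Chf : Ck k U (fun x => h (f x)).
  by apply: IH => [j jk|]; [apply: Cdh; apply: ltnW|apply: Ck_le].
apply: (@CkS _ _ _ (fun v x => dh (f x) * 'D_v f x)) => //.
- move=> x Ux; exact: Ck_continuous Chf Ux.
- move=> x v Ux; apply: is_derive_comp; [exact: Dh|exact: Ck_derive Cf Ux].
- move=> v; apply: CkM => //; first exact: Cdh.
  by case: Cf => _ /(_ v)[].
Qed.

Lemma Ck_exp k U f : open U -> Ck k U f -> Ck k U (fun x => expR (f x)).
Proof. by move=> oU; apply: Ck_comp => // x _; apply: is_derive_expR. Qed.

Lemma CkN k U f : open U -> Ck k U f -> Ck k U (fun x => - f x).
Proof.
move=> oU Cf; apply: (@Ck_ext _ _ (fun x => (-1) * f x)) => //.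
  by move=> x _; rewrite mulN1r.
by apply: CkM => //; apply: Ck_cst.
Qed.

Lemma CkV k U f : open U -> (forall x, U x -> f x != 0) ->
  Ck k U f -> Ck k U (fun x => (f x)^-1).
Proof.
move=> oU f0; apply: (@Ck_comp (fun y => y^-1) (fun y => - (y^-1 * y^-1))) => //.
  move=> x Ux; have := @is_deriveV R id (f x) 1 1 (f0 x Ux) _.
  by rewrite -exprVn expr2 [_%:A]mulr1; apply.
by move=> j _ Cf; apply: CkN => //; apply: CkM.
Qed.

Lemma Ck_sqrt k U f : open U -> (forall x, U x -> 0 < f x) ->
  Ck k U f -> Ck k U (fun x => Num.sqrt (f x)).
Proof.
move=> oU f0; apply: (@Ck_comp Num.sqrt (fun y => (2 * Num.sqrt y)^-1)) => //.
  by move=> x Ux; apply: is_derive1_sqrt; apply: f0.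
move=> j _ Cf; apply: CkV => //; last by apply: CkM => //; apply: Ck_cst.
by move=> x /f0 fx; rewrite mulf_neq0 ?pnatr_eq0// gt_eqF// sqrtr_gt0.
Qed.

Lemma Ck_lin k U f (df : V -> R) : open U -> continuous f ->
  (forall x v, is_derive x v f (df v)) -> Ck k U f.
Proof.
move=> oU cf Df; case: k => [|k]; first by split=> // x _; apply: cf.
by apply: (@CkS _ _ _ (fun v _ => df v)) => // [x _|v]; [apply: cf|apply: Ck_cst].
Qed.

Lemma Ck_subset k U U' f : U' `<=` U -> Ck k U f -> Ck k U' f.
Proof.
move=> UU; elim: k f => [|k IH] f [cf df]; first by split=> // x /UU; exact: cf.
split=> [x /UU|v]; first exact: cf.
by have [dv Cv] := df v; split=> [x /UU|]; [exact: dv|exact: IH].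
Qed.

Lemma Ck0_continuous f : (forall k, Ck k setT f) -> continuous f.
Proof. by move=> /(_ 0%N) [cf _] x; apply: cf. Qed.

End Smooth.

Section Auxiliary.
Variable R : realType.

Lemma Ck_mulr (c : R) k : Ck k [set: R^o] (fun t => t * c : R^o).
Proof.
apply: (@Ck_lin R R^o k setT (fun t => t * c) (fun v => v * c)).
- exact: openT.
- by move=> t; apply: continuousM; [exact: cvg_id|exact: cst_continuous].
- by move=> t v; apply: (@is_derive_linear R R^o (fun t => t * c)) => h z w;
    rewrite mulrDl /GRing.scale /= mulrA.
Qed.

Lemma open_interval0 (e : R) : open [set t : R^o | `|t| < e].
Proof.
rewrite (_ : mkset _ = ball (0 : R^o) e); first exact: ball_open.
by apply/seteqP; split=> t; rewrite /ball /= sub0r normrN.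
Qed.

Lemma mx_continuous (T : topologicalType) p q (f : T -> 'M[R]_(p, q)) :
  (forall i j, continuous (fun y => f y i j)) -> continuous f.
Proof.
move=> cf x; apply/cvg_ballP => e e0.
have H : \forall y \near x, forall i j, ball (f x i j) e (f y i j).
  apply: (@filter_forall T 'I_p (fun i y => forall j, ball (f x i j) e (f y i j))).
  move=> i; apply: (@filter_forall T 'I_q (fun j y => ball (f x i j) e (f y i j))).
  by move=> j; have /cvg_ballP := cf i j x; apply.
by apply: filterS H => y Hy; split.
Qed.

End Auxiliary.

(** * Complex matrix-valued functions *)

Section ComplexParts.
Variable R : realType.
Implicit Types z w : R[i].

Lemma eq_ReIm z w : Re z = Re w -> Im z = Im w -> z = w.
Proof. by case: z w => [a b] [c d] /= -> ->. Qed.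

Lemma cReM z w : Re (z * w) = Re z * Re w - Im z * Im w.
Proof. by case: z w => [a b] [c d]. Qed.

Lemma cImM z w : Im (z * w) = Re z * Im w + Im z * Re w.
Proof. by case: z w => [a b] [c d]. Qed.

Lemma cReD z w : Re (z + w) = Re z + Re w.
Proof. by case: z w => [a b] [c d]. Qed.

Lemma cImD z w : Im (z + w) = Im z + Im w.
Proof. by case: z w => [a b] [c d]. Qed.

Lemma cReN z : Re (- z) = - Re z.
Proof. by case: z. Qed.

Lemma cImN z : Im (- z) = - Im z.
Proof. by case: z. Qed.

Lemma cReJ z : Re (z^*) = Re z.
Proof. by case: z. Qed.

Lemma cImJ z : Im (z^*) = - Im z.
Proof. by case: z. Qed.

Lemma cReC (a : R) : Re a%:C = a.
Proof. by []. Qed.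

Lemma cImC (a : R) : Im a%:C = 0.
Proof. by []. Qed.

Lemma cReE (a b : R) : Re (Complex a b) = a.
Proof. by []. Qed.

Lemma cImE (a b : R) : Im (Complex a b) = b.
Proof. by []. Qed.

Lemma conjCr (a : R) : (a%:C)^* = a%:C.
Proof. by apply: eq_ReIm; rewrite ?cReJ ?cImJ //= oppr0. Qed.

Lemma cRe0 : Re (0 : R[i]) = 0. Proof. by []. Qed.

Lemma cRe_sum (I : Type) (r : seq I) (P : pred I) (F : I -> R[i]) :
  Re (\sum_(i <- r | P i) F i) = \sum_(i <- r | P i) Re (F i).
Proof. exact: (big_morph _ cReD cRe0). Qed.

End ComplexParts.

Section Derivative.
Variables (R : realType) (V : normedModType R) (x v : V).

Definition is_cderive (h : V -> R[i]) (d : R[i]) : Prop :=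
  is_derive x v (fun y => Re (h y) : R^o) (Re d) /\
  is_derive x v (fun y => Im (h y) : R^o) (Im d).

Lemma is_derive_ext (f g : V -> R^o) (d e : R) :
  is_derive x v f d -> f =1 g -> d = e -> is_derive x v g e.
Proof. by move=> ? /funext <- <-. Qed.

Lemma is_cderive_cst c : is_cderive (fun=> c) 0.
Proof. by split; apply: is_derive_cst. Qed.

Lemma is_cderiveD h1 h2 d1 d2 : is_cderive h1 d1 -> is_cderive h2 d2 ->
  is_cderive (fun y => h1 y + h2 y) (d1 + d2).
Proof.
move=> [r1 i1] [r2 i2]; split.
  by apply: is_derive_ext (is_deriveD r1 r2) _ _ => [y|]; rewrite cReD.
by apply: is_derive_ext (is_deriveD i1 i2) _ _ => [y|]; rewrite cImD.
Qed.

Lemma is_cderiveM h1 h2 d1 d2 : is_cderive h1 d1 -> is_cderive h2 d2 ->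
  is_cderive (fun y => h1 y * h2 y) (d1 * h2 x + h1 x * d2).
Proof.
move=> [r1 i1] [r2 i2]; split.
  apply: is_derive_ext (is_deriveB (is_deriveM r1 r2) (is_deriveM i1 i2)) _ _.
    by move=> y; rewrite cReM.
  by rewrite cReD !cReM /GRing.scale /=; ring.
apply: is_derive_ext (is_deriveD (is_deriveM r1 i2) (is_deriveM i1 r2)) _ _.
  by move=> y; rewrite cImM.
by rewrite cImD !cImM /GRing.scale /=; ring.
Qed.

Lemma is_cderive_conj h d : is_cderive h d -> is_cderive (fun y => (h y)^*) d^*.
Proof.
move=> [r i]; split; first by apply: is_derive_ext r _ _ => [y|]; rewrite cReJ.
by apply: is_derive_ext (is_deriveN i) _ _ => [y|]; rewrite cImJ.
Qed.

Lemma is_cderive_real (f : V -> R^o) (d : R) : is_derive x v f d ->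
  is_cderive (fun y => (f y)%:C) d%:C.
Proof. by move=> Df; split => //; apply: is_derive_cst. Qed.

Lemma is_cderive_sum (I : Type) (r : seq I) (P : pred I) (h : I -> V -> R[i]) d :
  (forall i, is_cderive (h i) (d i)) ->
  is_cderive (fun y => \sum_(i <- r | P i) h i y) (\sum_(i <- r | P i) d i).
Proof.
move=> Dh; elim: r => [|i r IH].
  rewrite big_nil; have -> : (fun y => \sum_(i <- [::] | P i) h i y) = fun=> 0.
    by apply/funext => y; rewrite big_nil.
  exact: is_cderive_cst.
have -> : (fun y => \sum_(i <- i :: r | P i) h i y) =
          (fun y => if P i then h i y + \sum_(i <- r | P i) h i y
                    else \sum_(i <- r | P i) h i y).
  by apply/funext => y; rewrite big_cons.
by rewrite big_cons; case: (P i) => //; apply: is_cderiveD.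
Qed.

Definition is_mxderive p q (f : V -> 'M[R[i]]_(p, q)) (M : 'M[R[i]]_(p, q)) :=
  forall i j, is_cderive (fun y => f y i j) (M i j).

Lemma is_mxderive_eq p q (f g : V -> 'M[R[i]]_(p, q)) M N :
  is_mxderive f M -> f =1 g -> M = N -> is_mxderive g N.
Proof. by move=> ? /funext <- <-. Qed.

Lemma mx_derive_val p q (f : V -> 'M[R[i]]_(p, q)) M :
  is_mxderive f M -> mx_derive f v x = M.
Proof.
move=> Df; apply/matrixP => i j; rewrite mxE.
by have [[_ ->] [_ ->]] := Df i j; case: (M i j).
Qed.

Lemma is_mxderive_cst p q (M : 'M[R[i]]_(p, q)) : is_mxderive (fun=> M) 0.
Proof. by move=> i j; rewrite mxE; apply: is_cderive_cst. Qed.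

Lemma is_mxderiveD p q (f g : V -> 'M[R[i]]_(p, q)) M N :
  is_mxderive f M -> is_mxderive g N -> is_mxderive (fun y => f y + g y) (M + N).
Proof.
move=> Df Dg i j; rewrite mxE.
rewrite (_ : (fun y => _) = fun y => f y i j + g y i j).
  exact: is_cderiveD.
by apply/funext => y; rewrite mxE.
Qed.

Lemma is_mxderive_mul p q r (f : V -> 'M[R[i]]_(p, q)) (g : V -> 'M[R[i]]_(q, r))
    M N : is_mxderive f M -> is_mxderive g N ->
  is_mxderive (fun y => f y *m g y) (M *m g x + f x *m N).
Proof.
move=> Df Dg i j; rewrite 3!mxE -big_split /=.
rewrite (_ : (fun y => _) = fun y => \sum_k f y i k * g y k j).
  by apply: is_cderive_sum => k; apply: is_cderiveM.
by apply/funext => y; rewrite mxE.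
Qed.

Lemma is_mxderive_mull p q r (A : 'M[R[i]]_(p, q)) (g : V -> 'M[R[i]]_(q, r)) N :
  is_mxderive g N -> is_mxderive (fun y => A *m g y) (A *m N).
Proof.
move=> Dg; have := is_mxderive_mul (is_mxderive_cst A) Dg.
by rewrite mul0mx add0r.
Qed.

Lemma is_mxderive_mulr p q r (f : V -> 'M[R[i]]_(p, q)) (A : 'M[R[i]]_(q, r)) M :
  is_mxderive f M -> is_mxderive (fun y => f y *m A) (M *m A).
Proof.
move=> Df; have := is_mxderive_mul Df (is_mxderive_cst A).
by rewrite mulmx0 addr0.
Qed.

Lemma is_mxderive_adj p q (f : V -> 'M[R[i]]_(p, q)) M :
  is_mxderive f M -> is_mxderive (fun y => (f y) ^t*) (M ^t*).
Proof.
move=> Df i j; rewrite 2!mxE.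
rewrite (_ : (fun y => _) = fun y => (f y j i)^*); first exact: is_cderive_conj.
by apply/funext => y; rewrite !mxE.
Qed.

Lemma is_mxderive_scale p q (a : V -> R^o) (A : 'M[R[i]]_(p, q)) (d : R) :
  is_derive x v a d -> is_mxderive (fun y => (a y)%:C *: A) (d%:C *: A).
Proof.
move=> Da i j; rewrite mxE.
rewrite (_ : (fun y => _) = fun y => (a y)%:C * A i j).
  have := is_cderiveM (is_cderive_real Da) (is_cderive_cst (A i j)).
  by rewrite mulr0 addr0.
by apply/funext => y; rewrite mxE.
Qed.

Lemma is_mxderive_diag n (a : V -> 'I_n -> R) (d : 'I_n -> R) :
  (forall j, is_derive x v (fun y => a y j : R^o) (d j)) ->
  is_mxderive (fun y => diag_mx (\row_j (a y j)%:C)) (diag_mx (\row_j (d j)%:C)).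
Proof.
move=> Da i j; rewrite !mxE.
rewrite (_ : (fun y => _) = fun y => (a y i *+ (i == j))%:C).
  rewrite -raddfMn; apply: is_cderive_real.
  case: (i == j); rewrite ?mulr1n ?mulr0n; first exact: Da.
  exact: is_derive_cst.
by apply/funext => y; rewrite !mxE raddfMn.
Qed.

Lemma is_mxderive_block m1 m2 n1 n2 (f1 : V -> 'M[R[i]]_(m1, n1))
    (f2 : V -> 'M[R[i]]_(m1, n2)) (f3 : V -> 'M[R[i]]_(m2, n1))
    (f4 : V -> 'M[R[i]]_(m2, n2)) M1 M2 M3 M4 :
  is_mxderive f1 M1 -> is_mxderive f2 M2 -> is_mxderive f3 M3 ->
  is_mxderive f4 M4 ->
  is_mxderive (fun y => block_mx (f1 y) (f2 y) (f3 y) (f4 y))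
              (block_mx M1 M2 M3 M4).
Proof.
move=> D1 D2 D3 D4 i j; rewrite !mxE.
rewrite (_ : (fun y => _) = fun y =>
  match fintype.split i with
  | inl i1 => match fintype.split j with inl j1 => f1 y i1 j1 | inr j2 => f2 y i1 j2 end
  | inr i2 => match fintype.split j with inl j1 => f3 y i2 j1 | inr j2 => f4 y i2 j2 end
  end); last first.
  apply/funext => y; rewrite mxE; case: (fintype.split i) => k; rewrite mxE;
  by case: (fintype.split j).
by case: (fintype.split i) => k; rewrite mxE; case: (fintype.split j).
Qed.

Lemma is_mxderive_ulsub m1 m2 n1 n2 (f : V -> 'M[R[i]]_(m1 + m2, n1 + n2)) M :
  is_mxderive f M -> is_mxderive (fun y => ulsubmx (f y)) (ulsubmx M).
Proof.
move=> Df i j; rewrite !mxE.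
rewrite (_ : (fun y => _) = fun y => f y (lshift m2 i) (lshift n2 j)) //.
by apply/funext => y; rewrite !mxE.
Qed.

Lemma is_mxderive_dlsub m1 m2 n1 n2 (f : V -> 'M[R[i]]_(m1 + m2, n1 + n2)) M :
  is_mxderive f M -> is_mxderive (fun y => dlsubmx (f y)) (dlsubmx M).
Proof.
move=> Df i j; rewrite !mxE.
rewrite (_ : (fun y => _) = fun y => f y (rshift m1 i) (lshift n2 j)) //.
by apply/funext => y; rewrite !mxE.
Qed.

End Derivative.

Lemma is_mxderive_smooth (R : realType) (V : normedModType R) p q (U : set V)
    (f : V -> 'M[R[i]]_(p, q)) x v :
  smooth_mx U f -> U x -> is_mxderive x v f (mx_derive f v x).
Proof.
move=> Cf Ux i j; rewrite mxE; split=> /=.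
  by apply: (@Ck_derive _ _ 0 U _ x v) => //; have [] := Cf i j 1%N.
by apply: (@Ck_derive _ _ 0 U _ x v) => //; have [] := Cf i j 1%N.
Qed.

Lemma is_mxderive_unique (R : realType) (V : normedModType R) (x v : V) p q
    (f : V -> 'M[R[i]]_(p, q)) M N :
  is_mxderive x v f M -> is_mxderive x v f N -> M = N.
Proof. by move=> /mx_derive_val <- /mx_derive_val <-. Qed.

Lemma is_mxderive_near (R : realType) p q (f h : R^o -> 'M[R[i]]_(p, q)) M (e : R) :
  0 < e ->
  (forall t : R, `|t| < e -> f t = h t) ->
  is_mxderive (0 : R^o) (1 : R^o) f M -> is_mxderive (0 : R^o) (1 : R^o) h M.
Proof.
move=> e0 fh Df i j.
have nfh : \forall t \near (0 : R^o), f t = h t.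
  by apply/nbhs_ballP; exists e => //= t; rewrite /ball /= sub0r normrN => /fh.
have [Dr Di] := Df i j.
by split; [apply: near_eq_is_derive Dr|apply: near_eq_is_derive Di];
  apply: filterS nfh => t ->.
Qed.

Lemma is_mxderive_0_cst (R : realType) p q (f : R -> 'M[R[i]]_(p, q)) :
  (forall t : R, is_mxderive (t : R^o) (1 : R^o) f 0) -> forall s t, f s = f t.
Proof.
move=> Df s t; apply/matrixP => i j; apply: eq_ReIm.
  apply: (@is_derive_0_is_cst R (fun s => Re (f s i j))) => y.
  by have [+ _] := Df y i j; rewrite mxE.
apply: (@is_derive_0_is_cst R (fun s => Im (f s i j))) => y.
by have [_ +] := Df y i j; rewrite mxE.
Qed.

Section SmoothMatrix.
Variables (R : realType) (V : normedModType R) (U : set V).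
Hypothesis oU : open U.

Definition csmooth (h : V -> R[i]) : Prop :=
  forall k, Ck k U (fun y => Re (h y)) /\ Ck k U (fun y => Im (h y)).

Lemma csmooth_cst c : csmooth (fun=> c).
Proof. by move=> k; split; apply: Ck_cst. Qed.

Lemma csmoothD h1 h2 : csmooth h1 -> csmooth h2 -> csmooth (fun y => h1 y + h2 y).
Proof.
move=> C1 C2 k; have [r1 i1] := C1 k; have [r2 i2] := C2 k; split.
  by apply: Ck_ext oU _ (CkD oU r1 r2) => y _; rewrite cReD.
by apply: Ck_ext oU _ (CkD oU i1 i2) => y _; rewrite cImD.
Qed.

Lemma csmoothM h1 h2 : csmooth h1 -> csmooth h2 -> csmooth (fun y => h1 y * h2 y).
Proof.
move=> C1 C2 k; have [r1 i1] := C1 k; have [r2 i2] := C2 k; split.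
  apply: Ck_ext oU _ (CkD oU (CkM oU r1 r2) (CkN oU (CkM oU i1 i2))) => y _.
  by rewrite cReM.
by apply: Ck_ext oU _ (CkD oU (CkM oU r1 i2) (CkM oU i1 r2)) => y _; rewrite cImM.
Qed.

Lemma csmooth_conj h : csmooth h -> csmooth (fun y => (h y)^*).
Proof.
move=> C k; have [r i] := C k; split.
  by apply: Ck_ext oU _ r => y _; rewrite cReJ.
by apply: Ck_ext oU _ (CkN oU i) => y _; rewrite cImJ.
Qed.

Lemma csmooth_real (f : V -> R^o) : (forall k, Ck k U f) ->
  csmooth (fun y => (f y)%:C).
Proof. by move=> C k; split=> //; apply: Ck_cst. Qed.

Lemma csmooth_sum (I : Type) (r : seq I) (P : pred I) (h : I -> V -> R[i]) :
  (forall i, csmooth (h i)) -> csmooth (fun y => \sum_(i <- r | P i) h i y).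
Proof.
move=> Ch; elim: r => [|i r IH].
  rewrite (_ : (fun y => _) = fun=> 0); first exact: csmooth_cst.
  by apply/funext => y; rewrite big_nil.
rewrite (_ : (fun y => _) = (fun y => if P i then h i y + \sum_(i <- r | P i) h i y
                    else \sum_(i <- r | P i) h i y)).
  by case: (P i) => //; apply: csmoothD.
by apply/funext => y; rewrite big_cons.
Qed.

Lemma smooth_mxP p q (f : V -> 'M[R[i]]_(p, q)) :
  smooth_mx U f <-> forall i j, csmooth (fun y => f y i j).
Proof. by split=> Cf i j k; apply: Cf. Qed.

Lemma smooth_mx_eq p q (f g : V -> 'M[R[i]]_(p, q)) :
  smooth_mx U f -> f =1 g -> smooth_mx U g.
Proof. by move=> ? /funext <-. Qed.

Lemma smooth_mx_cst p q (M : 'M[R[i]]_(p, q)) : smooth_mx U (fun=> M).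
Proof. by move=> i j; apply: csmooth_cst. Qed.

Lemma smooth_mxD p q (f g : V -> 'M[R[i]]_(p, q)) :
  smooth_mx U f -> smooth_mx U g -> smooth_mx U (fun y => f y + g y).
Proof.
move=> Cf Cg; apply/smooth_mxP => i j.
rewrite (_ : (fun y => _) = fun y => f y i j + g y i j).
  by apply: csmoothD; [apply: Cf|apply: Cg].
by apply/funext => y; rewrite mxE.
Qed.

Lemma smooth_mx_mul p q r (f : V -> 'M[R[i]]_(p, q)) (g : V -> 'M[R[i]]_(q, r)) :
  smooth_mx U f -> smooth_mx U g -> smooth_mx U (fun y => f y *m g y).
Proof.
move=> Cf Cg; apply/smooth_mxP => i j.
rewrite (_ : (fun y => _) = fun y => \sum_k f y i k * g y k j).
  by apply: csmooth_sum => k; apply: csmoothM; [apply: Cf|apply: Cg].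
by apply/funext => y; rewrite mxE.
Qed.

Lemma smooth_mx_adj p q (f : V -> 'M[R[i]]_(p, q)) :
  smooth_mx U f -> smooth_mx U (fun y => (f y) ^t*).
Proof.
move=> Cf; apply/smooth_mxP => i j.
rewrite (_ : (fun y => _) = fun y => (f y j i)^*).
  by apply: csmooth_conj; apply: Cf.
by apply/funext => y; rewrite !mxE.
Qed.

Lemma smooth_mx_scale p q (a : V -> R^o) (A : 'M[R[i]]_(p, q)) :
  (forall k, Ck k U a) -> smooth_mx U (fun y => (a y)%:C *: A).
Proof.
move=> Ca; apply/smooth_mxP => i j.
rewrite (_ : (fun y => _) = fun y => (a y)%:C * A i j).
  by apply: csmoothM; [apply: csmooth_real|apply: csmooth_cst].
by apply/funext => y; rewrite mxE.
Qed.

Lemma smooth_mx_diag n (a : V -> 'I_n -> R) :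
  (forall j k, Ck k U (fun y => a y j : R^o)) ->
  smooth_mx U (fun y => diag_mx (\row_j (a y j)%:C)).
Proof.
move=> Ca; apply/smooth_mxP => i j.
rewrite (_ : (fun y => _) = fun y => (a y i *+ (i == j))%:C).
  apply: csmooth_real => k; case: (i == j); rewrite ?mulr1n ?mulr0n.
    exact: Ca.
  exact: Ck_cst.
by apply/funext => y; rewrite !mxE raddfMn.
Qed.

Lemma smooth_mx_block m1 m2 n1 n2 (f1 : V -> 'M[R[i]]_(m1, n1))
    (f2 : V -> 'M[R[i]]_(m1, n2)) (f3 : V -> 'M[R[i]]_(m2, n1))
    (f4 : V -> 'M[R[i]]_(m2, n2)) :
  smooth_mx U f1 -> smooth_mx U f2 -> smooth_mx U f3 -> smooth_mx U f4 ->
  smooth_mx U (fun y => block_mx (f1 y) (f2 y) (f3 y) (f4 y)).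
Proof.
move=> C1 C2 C3 C4; apply/smooth_mxP => i j.
rewrite (_ : (fun y => _) = fun y =>
  match fintype.split i with
  | inl i1 => match fintype.split j with inl j1 => f1 y i1 j1 | inr j2 => f2 y i1 j2 end
  | inr i2 => match fintype.split j with inl j1 => f3 y i2 j1 | inr j2 => f4 y i2 j2 end
  end); last first.
  apply/funext => y; rewrite mxE; case: (fintype.split i) => k; rewrite mxE;
  by case: (fintype.split j).
by case: (fintype.split i) => k; case: (fintype.split j) => l;
  [apply: C1|apply: C2|apply: C3|apply: C4].
Qed.

Lemma smooth_mx_sub p q p' q' (f : V -> 'M[R[i]]_(p, q)) (s : 'I_p' -> 'I_p)
    (s' : 'I_q' -> 'I_q) :
  smooth_mx U f -> smooth_mx U (fun y => \matrix_(i, j) f y (s i) (s' j)).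
Proof.
move=> Sf; apply/smooth_mxP => i j.
rewrite (_ : (fun y => _) = fun y => f y (s i) (s' j)); first exact: Sf.
by apply/funext => y; rewrite mxE.
Qed.

End SmoothMatrix.

Lemma smooth_mx_subset (R : realType) (V : normedModType R) (U U' : set V) p q
    (f : V -> 'M[R[i]]_(p, q)) : U' `<=` U -> smooth_mx U f -> smooth_mx U' f.
Proof.
by move=> UU Sf i j k; have [Cr Ci] := Sf i j k; split; apply: Ck_subset UU _.
Qed.

(** * Conjugate transposes and the group U(n,m) *)

Section Adjoint.
Variable R : realType.
Local Notation C := R[i].

Lemma ctmxM p q r (A : 'M[C]_(p, q)) (B : 'M[C]_(q, r)) :
  (A *m B)^t* = B^t* *m A^t*.
Proof. by rewrite trmx_mul map_mxM. Qed.

Lemma ctmxD p q (A B : 'M[C]_(p, q)) : (A + B)^t* = A^t* + B^t*.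
Proof. by rewrite linearD /= map_mxD. Qed.

Lemma ctmxZ p q (a : C) (A : 'M[C]_(p, q)) : (a *: A)^t* = a^* *: A^t*.
Proof. by rewrite linearZ /= map_mxZ. Qed.

Lemma ctmx0 p q : (0 : 'M[C]_(p, q))^t* = 0.
Proof. by rewrite trmx0 map_mx0. Qed.

Lemma ctmx_scalar p (a : C) : (a%:M : 'M[C]_p)^t* = (a^*)%:M.
Proof. by rewrite tr_scalar_mx map_scalar_mx. Qed.

Lemma ctmx1 p : (1%:M : 'M[C]_p)^t* = 1%:M.
Proof. by rewrite ctmx_scalar rmorph1. Qed.

Lemma ctmx_diag p (d : 'rV[C]_p) : (diag_mx d)^t* = diag_mx (map_mx Num.conj d).
Proof. by rewrite tr_diag_mx map_diag_mx. Qed.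

Lemma ctmx_block m1 m2 n1 n2 (A : 'M[C]_(m1, n1)) (B : 'M[C]_(m1, n2))
    (D : 'M[C]_(m2, n1)) (E : 'M[C]_(m2, n2)) :
  (block_mx A B D E)^t* = block_mx (A^t*) (D^t*) (B^t*) (E^t*).
Proof. by rewrite tr_block_mx map_block_mx. Qed.

(** The trace of [A^* A] is the sum of the squared moduli of the entries. *)
Lemma ctmx_mul_eq0 p q (A : 'M[C]_(p, q)) : A^t* *m A = 0 -> A = 0.
Proof.
move=> A0; apply/matrixP => i j; rewrite mxE.
have := congr1 (fun M : 'M[C]_q => M j j) A0; rewrite !mxE => /eqP.
rewrite psumr_eq0 => [/allP /(_ i)|k _]; last by rewrite !mxE mulrC mul_conjC_ge0.
by rewrite mem_index_enum => /(_ isT); rewrite !mxE mulrC /= mul_conjC_eq0 => /eqP.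
Qed.

(** A sum of two positive semidefinite matrices vanishes only if both do; stack
    the two factors. *)
Lemma ctmx_mulD_eq0 p1 p2 q (A : 'M[C]_(p1, q)) (B : 'M[C]_(p2, q)) :
  A^t* *m A + B^t* *m B = 0 -> A = 0.
Proof.
move=> AB0; have : (col_mx A B)^t* *m col_mx A B = 0.
  by rewrite tr_col_mx map_row_mx mul_row_col.
by move=> /ctmx_mul_eq0; rewrite -[0]col_mx0 => /eq_col_mx[].
Qed.

Lemma ctmx_mul_diag_ge0 p q (A : 'M[C]_(p, q)) j : 0 <= (A^t* *m A) j j.
Proof.
rewrite mxE; apply: sumr_ge0 => i _; rewrite !mxE mulrC; exact: mul_conjC_ge0.
Qed.

End Adjoint.

Section Group.
Variables (R : realType) (n m : nat).
Local Notation C := R[i].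
Local Notation mat := 'M[C]_(n + m).
Local Notation L := (@Lambda R n m).
Implicit Types (g h k : mat).

Lemma LambdaK : L *m L = 1%:M.
Proof.
rewrite /Lambda mulmx_block !mulmx0 !mul0mx !addr0 !add0r mulmx1.
by rewrite mulNmx mulmxN opprK mulmx1 -scalar_mx_block.
Qed.

Lemma UnmP g : Unm g <-> g^t* *m L *m g = L.
Proof.
split=> [[]//|gL]; split=> //.
have /mulmx1_unit[_ //] : (L *m g^t* *m L) *m g = 1%:M.
by rewrite -!(mulmxA L) gL LambdaK.
Qed.

Lemma Unm_inv g : Unm g -> invmx g = L *m g^t* *m L.
Proof.
move=> [gu gL]; rewrite -[RHS]mulmx1 -(mulmxV gu) mulmxA.
by rewrite -!(mulmxA L) gL mulmxA LambdaK mul1mx.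
Qed.

Lemma Unm1 : Unm (1%:M : mat).
Proof. by apply/UnmP; rewrite ctmx1 mul1mx mulmx1. Qed.

Lemma UnmM g h : Unm g -> Unm h -> Unm (g *m h).
Proof.
move=> /UnmP Ug /UnmP Uh; apply/UnmP.
by rewrite ctmxM !mulmxA -(mulmxA _ (g^t*)) -(mulmxA _ (g^t* *m L)) Ug.
Qed.

Lemma UnmV g : Unm g -> Unm (invmx g).
Proof.
move=> Ug; have [gu gL] := Ug; apply/UnmP.
rewrite -{1}gL !mulmxA -ctmxM mulmxV // ctmx1 mul1mx -mulmxA mulmxV //.
by rewrite mulmx1.
Qed.

Lemma Unm_adj g : Unm g -> Unm (g^t*).
Proof.
move=> Ug; have [gu _] := Ug; apply/UnmP; rewrite trmxCK.
have := mulmxV gu; rewrite (Unm_inv Ug) !mulmxA => /(congr1 (mulmx^~ L)).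
by rewrite -(mulmxA _ L L) LambdaK mulmx1 mul1mx.
Qed.

Lemma Unm_blockP (a : 'M[C]_n) b c (d : 'M[C]_m) :
  Unm (block_mx a b c d) <->
  [/\ a^t* *m a = 1%:M + c^t* *m c, a^t* *m b = c^t* *m d
    & d^t* *m d = 1%:M + b^t* *m b].
Proof.
have E : (block_mx a b c d)^t* *m L *m block_mx a b c d =
  block_mx (c^t* *m c - a^t* *m a) (c^t* *m d - a^t* *m b)
           (d^t* *m c - b^t* *m a) (d^t* *m d - b^t* *m b).
  rewrite ctmx_block /Lambda !mulmx_block !mulmx0 !mulmxN !mulmx1 !addr0 !add0r.
  by rewrite !mulNmx ![- _ + _]addrC.
split=> [/UnmP|[ac ab db]].
  rewrite E => /eq_block_mx [/eqP ac /eqP ab _ /eqP db]; split; apply/eqP.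
  - by move: ac; rewrite subr_eq => /eqP ->; rewrite addrA subrr add0r.
  - by move: ab; rewrite subr_eq0 eq_sym.
  - by move: db; rewrite subr_eq.
apply/UnmP; rewrite E ac ab db /Lambda; congr block_mx.
- by rewrite opprD addrCA subrr addr0.
- by rewrite subrr.
- by rewrite -[d^t* *m c]trmxCK ctmxM trmxCK -ab ctmxM trmxCK subrr.
- by rewrite addrK.
Qed.

Lemma Unm_blockP' (a : 'M[C]_n) b c (d : 'M[C]_m) :
  Unm (block_mx a b c d) ->
  [/\ a *m a^t* = 1%:M + b *m b^t*, a *m c^t* = b *m d^t*
    & d *m d^t* = 1%:M + c *m c^t*].
Proof. by move=> /Unm_adj; rewrite ctmx_block => /Unm_blockP; rewrite !trmxCK. Qed.

(** [a a^* = 1 + b b^*] is positive definite, so a row killed by [a] is zero. *)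
Lemma Unm_a_unit (a : 'M[C]_n) b c (d : 'M[C]_m) :
  Unm (block_mx a b c d) -> a \in unitmx.
Proof.
move=> /Unm_blockP'[ac _ _]; rewrite -row_free_unit -kermx_eq0; apply/eqP.
move: (kermx a) (mulmx_ker a) => u ua0.
have : (u *m a) *m (u *m a)^t* = 0 by rewrite ua0 mul0mx.
rewrite ctmxM mulmxA -(mulmxA u) ac mulmxDr mulmx1 mulmxDl.
move=> H; have {}H : (u^t*)^t* *m u^t* + ((u *m b)^t*)^t* *m (u *m b)^t* = 0.
  by move: H; rewrite !trmxCK !ctmxM !mulmxA.
by rewrite -[u]trmxCK (ctmx_mulD_eq0 H) ctmx0.
Qed.

Lemma UnUmP k : UnUm k <-> exists (A : 'M[C]_n) (B : 'M[C]_m),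
  [/\ A^t* *m A = 1%:M, B^t* *m B = 1%:M & k = block_mx A 0 0 B].
Proof.
split=> -[A [B [uA uB ->]]]; exists A, B; split=> //.
- by apply: mulmx1C; apply/unitarymxP.
- by apply: mulmx1C; apply/unitarymxP.
- by apply/unitarymxP; apply: mulmx1C.
- by apply/unitarymxP; apply: mulmx1C.
Qed.

Lemma UnUm_Unm k : UnUm k -> Unm k.
Proof.
move=> /UnUmP[A [B [uA uB ->]]]; apply/Unm_blockP.
by split; rewrite ?ctmx0 ?mulmx0 ?mul0mx ?addr0.
Qed.

Lemma UnUm1 : UnUm (1%:M : mat).
Proof. by apply/UnUmP; exists 1%:M, 1%:M; rewrite !ctmx1 !mulmx1 -scalar_mx_block. Qed.

Lemma UnUmM k1 k2 : UnUm k1 -> UnUm k2 -> UnUm (k1 *m k2).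
Proof.
move=> /UnUmP[A [B [uA uB ->]]] /UnUmP[A' [B' [uA' uB' ->]]].
apply/UnUmP; exists (A *m A'), (B *m B').
rewrite !ctmxM mulmx_block !mulmx0 !mul0mx !addr0 !add0r; split=> //.
  by rewrite mulmxA -(mulmxA _ _ A) uA mulmx1.
by rewrite mulmxA -(mulmxA _ _ B) uB mulmx1.
Qed.

Lemma UnUmV k : UnUm k -> exists2 k', UnUm k' & k *m k' = 1%:M.
Proof.
move=> /UnUmP[A [B [uA uB ->]]]; exists (block_mx (A^t*) 0 0 (B^t*)).
  by apply/UnUmP; exists (A^t*), (B^t*); rewrite !trmxCK; split=> //; apply: mulmx1C.
rewrite mulmx_block !mulmx0 !mul0mx !addr0 !add0r (mulmx1C uA) (mulmx1C uB).
by rewrite -scalar_mx_block.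
Qed.

Lemma coset_eqP g h : coset g = coset h <-> exists2 k, UnUm k & g = h *m k.
Proof.
split=> [gh|[k Uk ->]].
  have : coset g g by exists 1%:M; [exact: UnUm1|rewrite mulmx1].
  by rewrite gh => -[k Uk <-]; exists k.
apply/seteqP; split=> [_ [k' Uk' <-]|_ [k' Uk' <-]].
  by exists (k *m k'); [apply: UnUmM|rewrite mulmxA].
have [k2 Uk2 kk2] := UnUmV Uk.
exists (k2 *m k'); first exact: UnUmM.
by rewrite mulmxA -(mulmxA h) kk2 mulmx1.
Qed.

Lemma coset_mulK g k : UnUm k -> coset (g *m k) = coset g.
Proof. by move=> Uk; apply/coset_eqP; exists k. Qed.

End Group.

(** * Exponentials in U(n,m) *)

Section Hyperbolic.
Variable R : realType.
Implicit Types x : R.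

Definition ch x : R := (expR x + expR (- x)) / 2.
Definition sh x : R := (expR x - expR (- x)) / 2.

Lemma ch2B_sh2 x : ch x ^+ 2 - sh x ^+ 2 = 1.
Proof.
by rewrite -[RHS](expRxMexpNx_1 x) /ch /sh; field.
Qed.

Lemma chN x : ch (- x) = ch x.
Proof. by rewrite /ch opprK addrC. Qed.

Lemma shN x : sh (- x) = - sh x.
Proof. by rewrite /sh opprK -mulNr opprB. Qed.

Lemma ch0 : ch 0 = 1.
Proof. by rewrite /ch oppr0 expR0; field. Qed.

Lemma sh0 : sh 0 = 0.
Proof. by rewrite /sh oppr0 subrr mul0r. Qed.

Lemma is_derive_expRN x :
  is_derive (x : R^o) (1 : R^o) (fun y => expR (- y) : R^o) (- expR (- x)).
Proof.
have := @is_derive1_comp R expR (fun y => - y) x (expR (- x)) (-1) _ _.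
by rewrite mulrN1; apply.
Qed.

Lemma is_derive_ch x : is_derive x 1 ch (sh x).
Proof.
have := is_deriveD (is_derive_expR x) (is_derive_expRN x).
move=> /(is_deriveZ (2^-1)).
by move=> H; apply: is_derive_ext H _ _ => [y|]; rewrite /ch /sh /GRing.scale /= mulrC.
Qed.

Lemma is_derive_sh x : is_derive x 1 sh (ch x).
Proof.
have := is_deriveB (is_derive_expR x) (is_derive_expRN x).
move=> /(is_deriveZ (2^-1)).
move=> H; apply: is_derive_ext H _ _ => [y|]; rewrite /ch /sh /GRing.scale /= mulrC //.
by rewrite opprK.
Qed.

Lemma ch_gt0 x : 0 < ch x.
Proof. by rewrite /ch divr_gt0// addr_gt0// expR_gt0. Qed.

Lemma sh_gt0 x : 0 < x -> 0 < sh x.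
Proof. by move=> x0; rewrite /sh divr_gt0// subr_gt0 ltr_expR; lra. Qed.

Lemma ch_gt1 x : 0 < x -> 1 < ch x.
Proof.
move=> /sh_gt0 s0; rewrite -(@ltr_pXn2r _ 2) ?nnegrE ?(ltW (ch_gt0 _))//.
by rewrite expr1n -(ch2B_sh2 x) ltrBlDr ltrDl exprn_gt0.
Qed.

(** Mean value theorem: the derivative [ch] exceeds 1 on positive reals. *)
Lemma sh_gt x : 0 < x -> x < sh x.
Proof.
move=> x0; have [|c] := MVT x0 (fun y _ => is_derive_sh y);
  last rewrite in_itv /= => /andP[c0 _].
  apply: continuous_subspaceT => y; apply: differentiable_continuous.
  by apply/derivable1_diffP; have [] := is_derive_sh y.
by rewrite sh0 !subr0 => ->; rewrite ltr_pMl// ch_gt1.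
Qed.

Lemma Ck_ch (V : normedModType R) k U (f : V -> R^o) :
  open U -> Ck k U f -> Ck k U (fun y => ch (f y)).
Proof.
move=> oU Cf; apply: CkM => //; last exact: Ck_cst.
by apply: CkD => //; apply: Ck_exp => //; apply: CkN.
Qed.

Lemma Ck_sh (V : normedModType R) k U (f : V -> R^o) :
  open U -> Ck k U f -> Ck k U (fun y => sh (f y)).
Proof.
move=> oU Cf; apply: CkM => //; last exact: Ck_cst.
apply: CkD => //; first exact: Ck_exp.
by apply: CkN => //; apply: Ck_exp => //; apply: CkN.
Qed.

End Hyperbolic.

Section Diagonal.
Variables (R : realType) (n : nat).
Local Notation C := R[i].
Implicit Types f g : 'I_n -> C.

Definition cdiag f : 'M[C]_n := diag_mx (\row_j f j).

Lemma cdiag_ext f g : f =1 g -> cdiag f = cdiag g.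
Proof. by move=> /funext ->. Qed.

Lemma cdiagE f i j : cdiag f i j = f i *+ (i == j).
Proof. by rewrite !mxE. Qed.

Lemma cdiagM f g : cdiag f *m cdiag g = cdiag (fun j => f j * g j).
Proof.
rewrite /cdiag mulmx_diag; congr diag_mx; apply/rowP => j; by rewrite !mxE.
Qed.

Lemma cdiagD f g : cdiag f + cdiag g = cdiag (fun j => f j + g j).
Proof. by apply/matrixP => i j; rewrite !mxE mulrnDl. Qed.

Lemma cdiagN f : - cdiag f = cdiag (fun j => - f j).
Proof. by apply/matrixP => i j; rewrite !mxE mulNrn. Qed.

Lemma cdiagZ a f : a *: cdiag f = cdiag (fun j => a * f j).
Proof. by apply/matrixP => i j; rewrite !mxE mulrnAr. Qed.

Lemma cdiag_const a : cdiag (fun=> a) = a%:M.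
Proof. by apply/matrixP => i j; rewrite !mxE. Qed.

Lemma cdiag_0 : cdiag (fun=> 0) = 0.
Proof. by apply/matrixP => i j; rewrite cdiagE mul0rn mxE. Qed.

Lemma cdiag_inj f g : cdiag f = cdiag g -> f =1 g.
Proof.
by move=> fg j; have := congr1 (fun M : 'M[C]_n => M j j) fg; rewrite !cdiagE eqxx.
Qed.

Lemma ctmx_cdiag f : (cdiag f)^t* = cdiag (fun j => (f j)^*).
Proof. by rewrite ctmx_diag /cdiag; congr diag_mx; apply/rowP => j; rewrite !mxE. Qed.

Lemma ctmx_cdiagr (a : 'I_n -> R) :
  (cdiag (fun j => (a j)%:C))^t* = cdiag (fun j => (a j)%:C).
Proof. by rewrite ctmx_cdiag; apply: cdiag_ext => j; rewrite conjCr. Qed.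

End Diagonal.

Section Exponential.
Variables (R : realType) (n m : nat).
Local Notation C := R[i].
Local Notation mat := 'M[C]_(n + m).
Implicit Types (A : 'M[C]_(m, n)) (r : 'I_n -> R) (t : R).

(** The entries of [exp (t hat A)] are built from [ch], and from [sh] and
    [ch - 1] divided by powers of [r]; [t] is kept apart from [r] so that the
    division does not degenerate at [t = 0]. *)
Definition shr t (r : R) := sh (t * r) / r.
Definition chr t (r : R) := (ch (t * r) - 1) / r ^+ 2.

(** The exponential of [t hat A] when [A^* A] is the diagonal matrix of the
    [r_j ^ 2]. *)
Definition expo t A r : mat :=
  block_mx (cdiag (fun j => (ch (t * r j))%:C))
           (cdiag (fun j => (shr t (r j))%:C) *m A^t*)
           (A *m cdiag (fun j => (shr t (r j))%:C))
           (1%:M + A *m cdiag (fun j => (chr t (r j))%:C) *m A^t*).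

Section Fixed.
Variables (A : 'M[C]_(m, n)) (r : 'I_n -> R).
Hypothesis r0 : forall j, r j != 0.
Hypothesis AA : A^t* *m A = cdiag (fun j => (r j ^+ 2)%:C).

Lemma chr_shr t j : 1 + r j ^+ 2 * chr t (r j) = ch (t * r j).
Proof. by rewrite /chr; field; apply: r0. Qed.

Lemma shr_sqr t j : r j ^+ 2 * shr t (r j) ^+ 2 = ch (t * r j) ^+ 2 - 1.
Proof.
rewrite -[in RHS](ch2B_sh2 (t * r j)) /shr; field; apply: r0.
Qed.

Lemma expo_Unm t : Unm (expo t A r).
Proof.
apply/Unm_blockP; split.
- rewrite ctmxM !ctmx_cdiagr cdiagM mulmxA -(mulmxA _ (A^t*)) AA !cdiagM.
  rewrite -(@cdiag_const R n 1) cdiagD; apply: cdiag_ext => j.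
  rewrite -!rmorphM -rmorphD /=; congr (_%:C).
  transitivity (1 + r j ^+ 2 * shr t (r j) ^+ 2); last by ring.
  by rewrite shr_sqr; ring.
- rewrite ctmxM !ctmx_cdiagr mulmxA cdiagM mulmxDr mulmx1 -!mulmxA.
  rewrite (mulmxA (A^t*) A) AA !mulmxA !cdiagM -mulmxDl cdiagD; congr (_ *m _).
  apply: cdiag_ext => j; rewrite -!rmorphM -rmorphD /=; congr (_%:C).
  by rewrite -chr_shr; ring.
- set K := cdiag (fun j => (chr _ _)%:C); set G := cdiag (fun j => (shr _ _)%:C).
  have KK : K + K + K *m (A^t* *m A) *m K = G *m G.
    rewrite AA !cdiagM !cdiagD; apply: cdiag_ext => j.
    rewrite -!rmorphM -!rmorphD /=; congr (_%:C).
    have /(congr1 (fun x => x / r j ^+ 2)) := shr_sqr t j.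
    rewrite mulrAC mulfV ?mul1r ?expf_neq0 // -expr2 => ->; rewrite /chr.
    by field; apply: r0.
  have [KS GS] : K^t* = K /\ G^t* = G by split; apply: ctmx_cdiagr.
  move: K G KS GS KK => K G KS GS KK.
  rewrite ctmxD !ctmxM ctmx1 !trmxCK KS GS mulmxDl mul1mx mulmxDr mulmx1 -addrA.
  congr (_ + _); rewrite !mulmxA -(mulmxA A G G) -KK !mulmxA.
  by rewrite !(mulmxDr, mulmxDl) !mulmxA addrA.
Qed.

End Fixed.
End Exponential.

Section Velocity.
Variables (R : realType) (n m : nat).
Local Notation C := R[i].
Local Notation mat := 'M[C]_(n + m).

(** For [g] in U(n,m) the inverse is [Lambda g^* Lambda], so its lower blocks
    are [- b^*] and [d^*]. *)
Lemma velocityE (V : normedModType R) (f : V -> mat) (x v : V) a' c' :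
  Unm (f x) -> is_mxderive x v (fun y => ulsubmx (f y)) a' ->
  is_mxderive x v (fun y => dlsubmx (f y)) c' ->
  velocity f v x = (drsubmx (f x))^t* *m c' - (ursubmx (f x))^t* *m a'.
Proof.
move=> Uf Da Dc; rewrite /velocity (Unm_inv Uf).
rewrite -[mx_derive f v x]submxK.
have -> : ulsubmx (mx_derive f v x) = a'.
  rewrite -(mx_derive_val Da); apply/matrixP => i j; rewrite !mxE.
  by congr (Complex _ _); congr ('D_v _ x); apply/funext => y; rewrite !mxE.
have -> : dlsubmx (mx_derive f v x) = c'.
  rewrite -(mx_derive_val Dc); apply/matrixP => i j; rewrite !mxE.
  by congr (Complex _ _); congr ('D_v _ x); apply/funext => y; rewrite !mxE.
rewrite -{1}[f x]submxK ctmx_block /Lambda !mulmx_block block_mxKdl.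
by rewrite !mulmx0 !mul0mx !mulmxN !mulmx1 !mul1mx ?addr0 ?add0r mulNmx addrC.
Qed.

Lemma velocity_left (V : normedModType R) (f : V -> mat) (x v : V) (g : mat) M :
  g \in unitmx -> f x \in unitmx -> is_mxderive x v f M ->
  velocity (fun y => g *m f y) v x = velocity f v x.
Proof.
move=> gu fu Df; rewrite /velocity (mx_derive_val (is_mxderive_mull g Df)).
rewrite (mx_derive_val Df) mulmxA; congr (dlsubmx (_ *m _)).
have gfu : g *m f x \in unitmx by rewrite unitmx_mul gu.
apply: (can_inj (mulKmx gfu)).
by rewrite mulmxA mulmxV // mul1mx mulmxK.
Qed.

Lemma geodesic_lift_left (A : 'M[C]_(m, n)) (c : R^o -> mat) (g : mat) :
  Unm g -> geodesic_lift A c -> geodesic_lift A (fun t => g *m c t).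
Proof.
move=> Ug [Uc Cc Dc]; split=> [t||t].
- exact: UnmM.
- by apply: smooth_mx_mul => //; [exact: openT|exact: smooth_mx_cst].
- rewrite -mulmxA -Dc; apply: mx_derive_val; apply: is_mxderive_mull.
  exact: is_mxderive_smooth Cc _.
Qed.

(** Along two lifts [c1], [c2] of a geodesic with the same velocity the product
    [c1 c2^-1 = c1 L c2^* L] is constant, since [hat A] is Hermitian and
    anticommutes with [L]. *)
Lemma geodesic_lift_unique (A : 'M[C]_(m, n)) (c1 c2 : R^o -> mat) :
  geodesic_lift A c1 -> geodesic_lift A c2 ->
  c1 0 = c2 0 -> c1 =1 c2.
Proof.
move=> [U1 S1 D1] [U2 S2 D2] c12 t.
have hL : hat A *m Lambda R n m = - (Lambda R n m *m (hat A)^t*).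
  rewrite /hat ctmx_block !ctmx0 trmxCK /Lambda !mulmx_block.
  by rewrite !mulmx0 !mul0mx !mulmxN !mulmx1 !mul1mx ?addr0 ?add0r ?mulNmx
     mul1mx opp_block_mx ?oppr0 opprK.
pose h (s : R) := c1 s *m Lambda R n m *m (c2 s)^t*.
have Dh (s : R) : is_mxderive (s : R^o) (1 : R^o) h 0.
  have d1 := @is_mxderive_smooth _ _ _ _ _ _ s 1 S1 I.
  have d2 := @is_mxderive_smooth _ _ _ _ _ _ s 1 S2 I.
  (* [c1' = c1 H] and [c2'^* = H^* c2^*] cancel across [L]. *)
  apply: is_mxderive_eq (is_mxderive_mul (is_mxderive_mulr _ d1)
    (is_mxderive_adj d2)) _ _ => //.
  rewrite D1 D2 -(mulmxA (c1 s)) hL ctmxM mulmxN mulNmx !mulmxA.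
  exact: addNr.
have gL (g : mat) : Unm g -> g *m Lambda R n m *m g^t* = Lambda R n m.
  by move=> /Unm_adj /UnmP; rewrite trmxCK.
have := is_mxderive_0_cst Dh t 0; rewrite /h c12 (gL _ (U2 0)) => E.
have [_ c2L] := U2 t.
rewrite -[c1 t]mulmx1 -(LambdaK R n m) -{2}c2L !mulmxA E LambdaK.
by rewrite mul1mx.
Qed.

End Velocity.

Section Family.
Variables (R : realType) (n m : nat).
Local Notation C := R[i].
Local Notation mat := 'M[C]_(n + m).

Lemma expo_lift (A : 'M[C]_(m, n)) (r : 'I_n -> R) :
  (forall j, r j != 0) -> A^t* *m A = cdiag (fun j => (r j ^+ 2)%:C) ->
  geodesic_lift A (fun t : R^o => expo t A r).
Proof.
move=> r0 AA; split=> [t||t]; first exact: expo_Unm.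
  have oT : open [set: R^o] by exact: openT.
  have Ct j k : Ck k [set: R^o] (fun t => t * r j : R^o).
    apply: (@Ck_lin R R^o k setT (fun t => t * r j) (fun v => v * r j)) => //.
      by move=> t; apply: continuousM; [exact: cvg_id|exact: cst_continuous].
    move=> t v; have := is_deriveM (is_derive_id t v) (is_derive_cst (r j) t v).
    move=> H; apply: is_derive_ext H _ _ => // ; rewrite scaler0 add0r.
    by rewrite /GRing.scale /= mulrC.
  have Cs j k : Ck k [set: R^o] (fun t => shr t (r j) : R^o).
    by apply: CkM => //; [apply: Ck_sh|apply: Ck_cst].
  apply: smooth_mx_block.
  - by apply: smooth_mx_diag => // j k; apply: Ck_ch.
  - apply: smooth_mx_mul => //; last exact: smooth_mx_cst.
    by apply: smooth_mx_diag.
  - apply: smooth_mx_mul => //; first exact: smooth_mx_cst.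
    by apply: smooth_mx_diag.
  - apply: smooth_mxD => //; first exact: smooth_mx_cst.
    apply: smooth_mx_mul => //; last exact: smooth_mx_cst.
    apply: smooth_mx_mul => //; first exact: smooth_mx_cst.
    apply: smooth_mx_diag => // j k; apply: CkM => //; last exact: Ck_cst.
    by apply: CkD => //; [apply: Ck_ch|apply: Ck_cst].
apply: mx_derive_val.
have Dtr j : is_derive t (1 : R^o) (fun s => s * r j : R^o) (r j).
  have := is_deriveM (is_derive_id t (1 : R^o)) (is_derive_cst (r j) t 1).
  by move=> H; apply: is_derive_ext H _ _ => //; rewrite scaler0 add0r; apply: mulr1.
have Dch j : is_derive t (1 : R^o) (fun s => ch (s * r j) : R^o) (sh (t * r j) * r j).
  by apply: is_derive_comp (Dtr j); apply: is_derive_ch.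
have Dsh j : is_derive t (1 : R^o) (fun s => shr s (r j) : R^o) (ch (t * r j)).
  have Ds : is_derive t (1 : R^o) (fun s => sh (s * r j) : R^o) (ch (t * r j) * r j).
    by apply: is_derive_comp (Dtr j); apply: is_derive_sh.
  have := is_deriveM Ds (is_derive_cst (r j)^-1 t 1).
  move=> H; apply: is_derive_ext H _ _ => //; rewrite scaler0 add0r.
  by rewrite /GRing.scale /= mulrCA mulVf// mulr1.
have Dcr j : is_derive t (1 : R^o) (fun s => chr s (r j) : R^o) (shr t (r j)).
  have := is_deriveM (is_deriveB (Dch j) (is_derive_cst (1 : R^o) t 1))
                     (is_derive_cst (r j ^- 2 : R^o) t 1).
  move=> H; apply: is_derive_ext H _ _ => //; rewrite scaler0 add0r subr0.
  by rewrite /GRing.scale /= /shr; field.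
have -> : expo t A r *m hat A =
  block_mx (cdiag (fun j => (sh (t * r j) * r j)%:C))
           (cdiag (fun j => (ch (t * r j))%:C) *m A^t*)
           (A *m cdiag (fun j => (ch (t * r j))%:C))
           (A *m cdiag (fun j => (shr t (r j))%:C) *m A^t*).
  rewrite /expo /hat mulmx_block !mulmx0 !addr0 !add0r; congr block_mx.
    rewrite -mulmxA AA cdiagM; apply: cdiag_ext => j.
    by rewrite -!rmorphM /= /shr; congr (_%:C); field.
  rewrite mulmxDl mul1mx -[X in X + _]mulmx1 -!mulmxA AA -mulmxDr; congr (_ *m _).
  rewrite cdiagM -(@cdiag_const R n 1) cdiagD; apply: cdiag_ext => j.
  rewrite -(rmorph1 (real_complex R)) -!rmorphM -rmorphD /=; congr (_%:C).
  by rewrite mulrC chr_shr.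
apply: is_mxderive_block.
- exact: is_mxderive_diag.
- by apply: is_mxderive_mulr; apply: is_mxderive_diag.
- by apply: is_mxderive_mull; apply: is_mxderive_diag.
- rewrite -[X in is_mxderive _ _ _ X]add0r; apply: is_mxderiveD.
    exact: is_mxderive_cst.
  by apply: is_mxderive_mulr; apply: is_mxderive_mull; apply: is_mxderive_diag.
Qed.

End Family.

(** * Jacobi fields *)

Section Jacobi.
Variables (R : realType) (n m : nat).
Local Notation C := R[i].
Local Notation mat := 'M[C]_(n + m).

(** The derivative at [s = 0] of [exp (t hat (A + s B)) o], read in the frame
    [exp (t hat A)], when the Gram matrices are diagonal: [A^* A] has entries
    [a_j ^ 2] and [A^* B] has entries [g_j].  It acts columnwise.  On the column
    spanned by [A_j] over C, the real direction is flat and gets the factor [t],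
    the direction [i A_j] has the largest curvature and gets
    [sh (2 t a_j) / (2 a_j)], and the orthogonal complement of [A_j] gets
    [sh (t a_j) / a_j]. *)
Definition jacobi t (A B : 'M[C]_(m, n)) (a : 'I_n -> R) (g : 'I_n -> C) :=
  B *m cdiag (fun j => (shr t (a j))%:C) +
  A *m cdiag (fun j => Complex ((t - shr t (a j)) / a j ^+ 2 * Re (g j))
                               (chr t (a j) * shr t (a j) * Im (g j))).

Variables (A B : 'M[C]_(m, n)) (a b : 'I_n -> R) (g : 'I_n -> C).
Hypothesis a0 : forall j, 0 < a j.
Hypothesis AA : A^t* *m A = cdiag (fun j => (a j ^+ 2)%:C).
Hypothesis AB : A^t* *m B = cdiag g.
Hypothesis BB : B^t* *m B = cdiag (fun j => (b j)%:C).

Let p (s : R) j : R := a j ^+ 2 + s * (2 * Re (g j)) + s * s * b j.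
Let rho (s : R) j : R := Num.sqrt (p s j).

Lemma BA_cdiag : B^t* *m A = cdiag (fun j => (g j)^*).
Proof. by rewrite -ctmx_cdiag -AB ctmxM trmxCK. Qed.

Lemma family_gram s :
  (A + s%:C *: B)^t* *m (A + s%:C *: B) = cdiag (fun j => (p s j)%:C).
Proof.
rewrite ctmxD ctmxZ conjCr mulmxDl !mulmxDr -!scalemxAr -!scalemxAl AA AB BA_cdiag BB.
rewrite !cdiagZ !cdiagD; apply: cdiag_ext => j; apply: eq_ReIm.
  by rewrite !(cReD, cReM, cImM, cReC, cImC, cReJ, cImJ) /p; ring.
by rewrite !(cImD, cReM, cImM, cReC, cImC, cReJ, cImJ); ring.
Qed.

Lemma is_derive_p j : is_derive (0 : R^o) (1 : R^o) (fun s => p s j : R^o) (2 * Re (g j)).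
Proof.
pose id1 := is_derive_id (0 : R^o) (1 : R^o).
pose cs (c : R^o) := is_derive_cst c (0 : R^o) (1 : R^o).
have := is_deriveD (is_deriveD (cs (a j ^+ 2)) (is_deriveM id1 (cs (2 * Re (g j)))))
  (is_deriveM (is_deriveM id1 id1) (cs (b j))).
move=> H; apply: is_derive_ext H _ _ => //.
by rewrite /GRing.scale /=; ring.
Qed.

(** The family [A + s B] keeps nonzero columns for small [s], which makes the
    square roots [rho s j] smooth. *)
Lemma family_pos : exists2 e : R, 0 < e & forall s j, `|s| < e -> 0 < p s j.
Proof.
have np j : \forall s \near (0 : R), 0 < p s j.
  have cp : {for 0, continuous (fun s => p s j)}.
    apply: differentiable_continuous; apply/derivable1_diffP.
    by have [] := is_derive_p j.
  apply: (cvgr_gt _ cp); rewrite /p !mul0r !addr0 exprn_gt0//.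
have : \forall s \near (0 : R), forall j, 0 < p s j.
  exact: (@filter_forall R 'I_n (fun j s => is_true (0 < p s j)) _ _ np).
move=> /nbhs_ballP[e /= e0 he]; exists e => // s j se.
by apply: he; rewrite /ball /= sub0r normrN.
Qed.

Lemma rho0 : rho 0 = a.
Proof.
by apply/funext => j; rewrite /rho /p !mul0r !addr0 sqrtr_sqr gtr0_norm.
Qed.

Lemma is_derive_rho j :
  is_derive (0 : R^o) (1 : R^o) (fun s => rho s j : R^o) (Re (g j) / a j).
Proof.
have p0 : p 0 j = a j ^+ 2 by rewrite /p !mul0r !addr0.
have p0' : 0 < p 0 j by rewrite p0 exprn_gt0.
have := @is_derive_comp R R^o Num.sqrt (fun s => p s j) 0 1 _ _
  (is_derive1_sqrt p0') (is_derive_p j).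
move=> H; apply: is_derive_ext H _ _ => //.
rewrite p0 sqrtr_sqr gtr0_norm//; field; exact/lt0r_neq0.
Qed.

Lemma family_smooth t e : (forall s j, `|s| < e -> 0 < p s j) ->
  smooth_mx [set s : R^o | `|s| < e]
    (fun s => expo t (A + s%:C *: B) (rho s)).
Proof.
move=> pe; have oU := @open_interval0 R e.
have Cs k : Ck k [set s : R^o | `|s| < e] (fun s => s).
  apply: (@Ck_lin R R^o k _ id id) => //; move=> ?; exact: cvg_id.
have Cc k (c : R^o) : Ck k [set s : R^o | `|s| < e] (fun=> c) by exact: Ck_cst.
have Cp k j : Ck k [set s : R^o | `|s| < e] (fun s => p s j : R^o).
  by do !apply: CkD => //; do !apply: CkM => //.
have Cr k j : Ck k [set s : R^o | `|s| < e] (fun s => rho s j : R^o).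
  by apply: Ck_sqrt => // s /pe.
have r0 s j : `|s| < e -> rho s j != 0.
  by move=> /pe pj; rewrite gt_eqF// sqrtr_gt0.
have Cch k j : Ck k [set s : R^o | `|s| < e] (fun s => ch (t * rho s j) : R^o).
  by apply: Ck_ch => //; apply: CkM.
have Csh k j : Ck k [set s : R^o | `|s| < e] (fun s => shr t (rho s j) : R^o).
  apply: CkM => //; first by apply: Ck_sh => //; apply: CkM.
  by apply: CkV => // s /r0.
have Ccr k j : Ck k [set s : R^o | `|s| < e] (fun s => chr t (rho s j) : R^o).
  apply: CkM => //; first by apply: CkD.
  apply: CkV => //; first by move=> s /r0 ?; rewrite expf_neq0.
  by apply: Ck_ext oU _ (CkM oU (Cr k j) (Cr k j)).
have CZ : smooth_mx [set s : R^o | `|s| < e] (fun s => A + s%:C *: B).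
  by apply: smooth_mxD => //; apply: smooth_mx_scale.
apply: smooth_mx_block; first exact: smooth_mx_diag.
- by apply: smooth_mx_mul => //; [exact: smooth_mx_diag|exact: smooth_mx_adj].
- by apply: smooth_mx_mul => //; exact: smooth_mx_diag.
- apply: smooth_mxD => //.
  apply: smooth_mx_mul => //; last exact: smooth_mx_adj.
  by apply: smooth_mx_mul => //; exact: smooth_mx_diag.
Qed.

Lemma family0 t : expo t (A + (0 : R)%:C *: B) (rho 0) = expo t A a.
Proof. by rewrite scale0r addr0 rho0. Qed.

(** By [velocityE] only the first block column of the exponential matters. *)
Lemma family_velocity t :
  velocity (fun s : R^o => expo t (A + s%:C *: B) (rho s)) 1 0 =
  jacobi t A B a g.
Proof.
have an0 j : a j != 0 by exact: lt0r_neq0.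
have Dch j : is_derive (0 : R^o) (1 : R^o) (fun s => ch (t * rho s j) : R^o)
    (sh (t * a j) * (t * (Re (g j) / a j))).
  apply: is_derive_comp; first by rewrite rho0; exact: is_derive_ch.
  have := is_deriveZ t (is_derive_rho j).
  by move=> H; apply: is_derive_ext H _ _.
have Dsh j : is_derive (0 : R^o) (1 : R^o) (fun s => shr t (rho s j) : R^o)
    ((ch (t * a j) * t * a j - sh (t * a j)) / a j ^+ 2 * (Re (g j) / a j)).
  have Ds : is_derive (0 : R^o) (1 : R^o) (fun s => sh (t * rho s j) : R^o)
      (ch (t * a j) * (t * (Re (g j) / a j))).
    apply: is_derive_comp; first by rewrite rho0; exact: is_derive_sh.
    have := is_deriveZ t (is_derive_rho j).
    by move=> H; apply: is_derive_ext H _ _.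
  have rn0 : rho 0 j != 0 by rewrite rho0.
  have := is_deriveM Ds (@is_deriveV R (fun s => rho s j) 0 _ 1 rn0 (is_derive_rho j)).
  move=> H; apply: is_derive_ext H _ _ => //.
  by rewrite rho0 /GRing.scale /=; field.
have DZ : is_mxderive (0 : R^o) (1 : R^o) (fun s => A + s%:C *: B) B.
  apply: is_mxderive_eq (is_mxderiveD (is_mxderive_cst _ _ A)
     (is_mxderive_scale B (is_derive_id (0 : R^o) (1 : R^o)))) _ _ => //.
  by rewrite scale1r add0r.
rewrite (@velocityE _ _ _ _ _ _ _
  (cdiag (fun j => (sh (t * a j) * (t * (Re (g j) / a j)))%:C))
  (B *m cdiag (fun j => (shr t (a j))%:C) +
   A *m cdiag (fun j => ((ch (t * a j) * t * a j - sh (t * a j)) / a j ^+ 2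
                         * (Re (g j) / a j))%:C))); first last.
- apply: is_mxderive_eq (is_mxderive_mul DZ (is_mxderive_diag Dsh)) _ _.
    by move=> s; rewrite /expo block_mxKdl.
  by rewrite rho0 scale0r addr0.
- apply: is_mxderive_eq (is_mxderive_diag Dch) _ _ => //.
  by move=> s; rewrite /expo block_mxKul.
- by rewrite family0; apply: expo_Unm.
rewrite family0 /expo block_mxKdr block_mxKur /jacobi.
rewrite ctmxD !ctmxM !ctmx1 !ctmx_cdiagr !trmxCK mulmxDl mul1mx -addrA -addrA.
congr (_ + _); rewrite -!mulmxA -mulmxBr -mulmxDr; congr (_ *m _).
rewrite (mulmxDr (A^t*)) !(mulmxA (A^t*)) AA AB !cdiagM !cdiagD !cdiagM.
rewrite cdiagN !cdiagD; apply: cdiag_ext => j.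
have chE : chr t (a j) = (ch (t * a j) - 1) / a j ^+ 2 by [].
have := ch2B_sh2 (t * a j); rewrite chE /shr.
move: (ch (t * a j)) (sh (t * a j)) => cc ss /eqP; rewrite subr_eq => /eqP c2.
have aj := an0 j; move: (a j) aj => aa aa0.
case: (g j) => u v; apply: eq_ReIm.
  rewrite !(cReD, cImD, cReN, cReM, cImM, cReC, cImC) /=.
  rewrite !(mulr0, mul0r, subr0, addr0, oppr0).
  rewrite [RHS](_ : _ = ((cc ^+ 2 - ss ^+ 2) * t - ss / aa) / aa ^+ 2 * u).
    by field.
  by rewrite c2 addrK mul1r.
rewrite !(cReD, cImD, cImN, cReM, cImM, cReC, cImC) /=.
by field.
Qed.

End Jacobi.

Section Transport.
Variables (R : realType) (n m : nat).
Local Notation C := R[i].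
Local Notation mat := 'M[C]_(n + m).

(** For complete totally geodesic S the geodesics tangent to S stay in S for
    all times: this is how these hypotheses are used in the proof of necessity. *)
Definition contains_geodesics (S : set (set mat)) : Prop :=
  forall g A c, Unm g -> tangent S g A -> geodesic_lift A c -> c 0 = g ->
  forall t, S (coset (c t)).

Lemma contains_geodesicsP (S : set (set mat)) :
  totally_geodesic S -> geodesically_complete S -> contains_geodesics S.
Proof.
move=> tgS gcS g A c Ug TA Lc c0.
have Sg : S (coset g).
  have [e [c' [e0 _ Sc' <- _]]] := TA.
  by apply: (Sc' 0 _).2; rewrite normr0.
have [e e0 Sc] := tgS _ _ _ Ug Sg TA Lc c0.
exact: gcS e0 Lc Sc.
Qed.

Lemma expo0 (A : 'M[C]_(m, n)) r : expo 0 A r = 1%:M.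
Proof.
have c1 : cdiag (fun j => (ch (0 * r j))%:C) = 1%:M :> 'M[C]_n.
  by rewrite -cdiag_const; apply: cdiag_ext => j; rewrite mul0r ch0.
have c2 : cdiag (fun j => (shr 0 (r j))%:C) = 0 :> 'M[C]_n.
  rewrite -cdiag_0; apply: cdiag_ext => j.
  by rewrite /shr mul0r sh0 mul0r.
have c3 : cdiag (fun j => (chr 0 (r j))%:C) = 0 :> 'M[C]_n.
  rewrite -cdiag_0; apply: cdiag_ext => j.
  by rewrite /chr mul0r ch0 subrr mul0r.
by rewrite /expo c1 c2 c3 !(mul0mx, mulmx0) addr0 -scalar_mx_block.
Qed.

Lemma expo_invol (A : 'M[C]_(m, n)) r :
  (forall j, r j != 0) -> A^t* *m A = cdiag (fun j => (r j ^+ 2)%:C) ->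
  expo 1 A r *m expo (-1) A r = 1%:M.
Proof.
move=> r0 AA; have UE := expo_Unm r0 AA 1.
have -> : expo (-1) A r = invmx (expo 1 A r).
  rewrite (Unm_inv UE) /expo ctmx_block /Lambda !mulmx_block.
  rewrite !mulmx0 !mul0mx !addr0 !add0r !mulNmx !mulmxN !mul1mx !mulmx1 opprK.
  rewrite ctmxD !ctmxM !ctmx1 !ctmx_cdiagr !trmxCK -!mulmxA.
  have chrN j : chr (-1) (r j) = chr 1 (r j) by rewrite /chr mulN1r chN mul1r.
  have shrN j : shr (-1) (r j) = - shr 1 (r j).
    by rewrite /shr mulN1r shN mul1r mulNr.
  have -> : cdiag (fun j => (ch (-1 * r j))%:C) = cdiag (fun j => (ch (1 * r j))%:C).
    by apply: cdiag_ext => j; rewrite mulN1r chN mul1r.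
  have -> : cdiag (fun j => (shr (-1) (r j))%:C) = - cdiag (fun j => (shr 1 (r j))%:C).
    by rewrite cdiagN; apply: cdiag_ext => j; rewrite shrN rmorphN.
  have -> : cdiag (fun j => (chr (-1) (r j))%:C) = cdiag (fun j => (chr 1 (r j))%:C).
    by apply: cdiag_ext => j; rewrite chrN.
  by rewrite mulNmx mulmxN.
by apply: mulmxV; have [] := UE.
Qed.

(** The curve [s |-> exp (t hat (A + s B))] stays in S, because each of its
    points is on a geodesic tangent to S at [g0]. *)
Lemma tangent_jacobi (S : set (set mat)) (g0 : mat) (A B : 'M[C]_(m, n))
    (a b : 'I_n -> R) (g : 'I_n -> C) t :
  contains_geodesics S -> Unm g0 -> (forall j, 0 < a j) ->
  A^t* *m A = cdiag (fun j => (a j ^+ 2)%:C) -> A^t* *m B = cdiag g ->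
  B^t* *m B = cdiag (fun j => (b j)%:C) ->
  (forall s : R, tangent S g0 (A + s%:C *: B)) ->
  tangent S (g0 *m expo t A a) (jacobi t A B a g).
Proof.
move=> cgS Ug a0 AA AB BB TAB.
have [e e0 pe] := family_pos b g a0.
have Cf := family_smooth A B t pe.
pose p (s : R) j : R := a j ^+ 2 + s * (2 * Re (g j)) + s * s * b j.
pose rho (s : R) j : R := Num.sqrt (p s j).
have rn0 s : `|s| < e -> forall j, rho s j != 0.
  by move=> se j; rewrite gt_eqF// sqrtr_gt0; apply: pe.
have gram s : `|s| < e -> (A + s%:C *: B)^t* *m (A + s%:C *: B) =
    cdiag (fun j => (rho s j ^+ 2)%:C).
  move=> se; rewrite (family_gram AA AB BB); apply: cdiag_ext => j.
  by rewrite sqr_sqrtr //; apply/ltW/pe.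
have h0 : `|0 : R| < e by rewrite normr0.
have oU := @open_interval0 R e.
exists e, (fun s => g0 *m expo t (A + s%:C *: B) (rho s)); split.
- exact: e0.
- by apply: smooth_mx_mul => //; exact: smooth_mx_cst.
- move=> s se; split.
    by apply: UnmM => //; apply: expo_Unm; [exact: rn0|exact: gram].
  have Lc := geodesic_lift_left Ug (expo_lift (rn0 _ se) (gram _ se)).
  by refine (cgS _ _ _ Ug (TAB s) Lc _ t); rewrite expo0 mulmx1.
- by rewrite (family0 A B b g a0).
- have Df := is_mxderive_smooth (1 : R^o) Cf h0.
  have [gu _] := Ug.
  have [fu _] : Unm (expo t (A + (0 : R)%:C *: B) (rho 0)).
    by apply: expo_Unm; [exact: rn0|exact: gram].
  by rewrite (velocity_left gu fu Df) (family_velocity b a0 AA AB).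
Qed.

Section JacobiAlgebra.
Variables (A B : 'M[C]_(m, n)) (a b : 'I_n -> R) (g : 'I_n -> C).
Hypothesis a0 : forall j, a j != 0.
Hypothesis AA : A^t* *m A = cdiag (fun j => (a j ^+ 2)%:C).
Hypothesis AB : A^t* *m B = cdiag g.
Hypothesis BB : B^t* *m B = cdiag (fun j => (b j)%:C).

(** The hypotheses on the Gram matrices of the pair [A], [B] are inherited by
    [A] and its Jacobi field, which allows iteration. *)
Lemma jacobi_gram t : A^t* *m jacobi t A B a g =
  cdiag (fun j => Complex (t * Re (g j)) (ch (t * a j) * shr t (a j) * Im (g j))).
Proof.
rewrite /jacobi mulmxDr !mulmxA AB AA !cdiagM cdiagD; apply: cdiag_ext => j.
apply: eq_ReIm; rewrite !(cReD, cImD, cReM, cImM, cReE, cImE, cReC, cImC).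
  by field.
by rewrite /chr; field.
Qed.

Lemma jacobi_normal t : exists b', (jacobi t A B a g)^t* *m jacobi t A B a g =
  cdiag (fun j => (b' j)%:C).
Proof.
rewrite /jacobi; set f := fun j => Complex _ _.
have BA : B^t* *m A = cdiag (fun j => (g j)^*) by rewrite -ctmx_cdiag -AB ctmxM trmxCK.
exists (fun j => shr t (a j) * b j * shr t (a j) +
  2 * Re ((f j)^* * g j) * shr t (a j) + a j ^+ 2 * Re ((f j)^* * f j)).
set D := cdiag (fun j => (shr _ _)%:C); set F := cdiag f.
have -> : (B *m D + A *m F)^t* *m (B *m D + A *m F) =
   D^t* *m (B^t* *m B) *m D + F^t* *m (A^t* *m B) *m D +
   (D^t* *m (B^t* *m A) *m F + F^t* *m (A^t* *m A) *m F).
  by move: D F => D F; rewrite ctmxD !ctmxM mulmxDl !mulmxDr !mulmxA addrACA.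
rewrite ctmx_cdiagr ctmx_cdiag AA AB BA BB !cdiagM !cdiagD.
apply: cdiag_ext => j; case: (f j) (g j) => [u v] [x y].
by apply: eq_ReIm; rewrite !(cReD, cImD, cReM, cImM, cReC, cImC, cReJ, cImJ) /=; ring.
Qed.

(** [A] is its own Jacobi field at time 1, so [A + s J_A (B)] is the Jacobi
    field of [A + s B]: sums of tangent vectors of this kind are tangent,
    without any knowledge of the tangent space at the end point. *)
Lemma jacobi_affine (s : R) :
  jacobi 1 A (A + s%:C *: B) a (fun j => (a j ^+ 2)%:C + s%:C * g j) =
  A + s%:C *: jacobi 1 A B a g.
Proof.
rewrite /jacobi; set D := cdiag (fun j => (shr _ _)%:C).
set W' := cdiag _; set W := cdiag _.
suff E : D + W' = 1%:M + s%:C *: W.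
  rewrite mulmxDl -scalemxAl scalerDr addrAC -mulmxDr E mulmxDr mulmx1.
  by rewrite -scalemxAr -addrA (addrC (_ *: _)).
rewrite cdiagZ -(@cdiag_const R n 1) !cdiagD; apply: cdiag_ext => j.
apply: eq_ReIm; rewrite !(cReD, cImD, cReM, cImM, cReE, cImE, cReC, cImC).
  by field.
by ring.
Qed.

End JacobiAlgebra.
End Transport.

(** * Necessity *)

Section Forward.
Variables (R : realType) (n m : nat).
Local Notation C := R[i].
Local Notation mat := 'M[C]_(n + m).

Section Twice.
Variables (A B : 'M[C]_(m, n)) (a b : 'I_n -> R) (g : 'I_n -> C).
Hypothesis a0 : forall j, 0 < a j.
Hypothesis AA : A^t* *m A = cdiag (fun j => (a j ^+ 2)%:C).
Hypothesis AB : A^t* *m B = cdiag g.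
Hypothesis BB : B^t* *m B = cdiag (fun j => (b j)%:C).

Lemma jacobi_twice :
  jacobi (-1) A (jacobi 1 A B a g) a
    (fun j => Complex (1 * Re (g j)) (ch (1 * a j) * shr 1 (a j) * Im (g j))) =
  - (B *m cdiag (fun j => (shr 1 (a j) ^+ 2)%:C) +
     A *m cdiag (fun j => Complex ((1 - shr 1 (a j) ^+ 2) / a j ^+ 2 * Re (g j))
                                  (shr 1 (a j) ^+ 4 * Im (g j)))).
Proof.
have an0 j : a j != 0 by exact: lt0r_neq0.
have chrN j : chr (-1) (a j) = chr 1 (a j) by rewrite /chr mulN1r chN mul1r.
have shrN j : shr (-1) (a j) = - shr 1 (a j).
  by rewrite /shr mulN1r shN mul1r mulNr.
rewrite /jacobi.
set s1 := cdiag (fun j => (shr (-1) _)%:C); set s2 := cdiag (fun j => (shr 1 _)%:C).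
set w1 := cdiag _; set w2 := cdiag _; set s3 := cdiag _; set w3 := cdiag _.
have Es : s2 *m s1 = - s3.
  rewrite /s2 /s1 /s3 cdiagM cdiagN; apply: cdiag_ext => j.
  by rewrite shrN -rmorphM -rmorphN /=; congr (_%:C); ring.
have Ew : w1 *m s1 + w2 = - w3.
  rewrite /w1 /w2 /s1 /w3 cdiagM cdiagN cdiagD; apply: cdiag_ext => j.
  have e2 : chr 1 (a j) * (1 + ch (1 * a j)) = shr 1 (a j) ^+ 2.
    have := shr_sqr an0 1 j; rewrite /chr => E.
    by rewrite mulrAC -[RHS](mulKf (expf_neq0 2 (an0 j))) E; ring.
  apply: eq_ReIm;
    rewrite !(cReD, cImD, cReN, cImN, cReM, cImM, cReE, cImE, cReC, cImC) shrN ?chrN.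
    by field.
  rewrite -[shr 1 (a j) ^+ 4]/(shr 1 (a j) ^+ (2 + 2)) exprD -{2}e2; ring.
move: s1 s2 s3 w1 w2 w3 Es Ew => s1 s2 s3 w1 w2 w3 Es Ew.
by rewrite mulmxDl -!mulmxA Es -addrA -mulmxDr Ew !mulmxN opprD.
Qed.

(** Follow the geodesic of [A] from [g0] up to time 1, then the one of
    [A + s C] up to time -1, where [C] is the Jacobi field of [B]: the end
    points form a curve of S through [g0]. *)
Lemma tangent_jacobi_twice (S : set (set mat)) (g0 : mat) :
  contains_geodesics S -> Unm g0 ->
  (forall s t : R, tangent S g0 (s%:C *: A + t%:C *: B)) ->
  tangent S g0 (- (B *m cdiag (fun j => (shr 1 (a j) ^+ 2)%:C) +
     A *m cdiag (fun j => Complex ((1 - shr 1 (a j) ^+ 2) / a j ^+ 2 * Re (g j))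
                                  (shr 1 (a j) ^+ 4 * Im (g j))))).
Proof.
move=> cgS Ug TAB; have an0 j : a j != 0 by exact: lt0r_neq0.
rewrite -jacobi_twice.
have TC s : tangent S (g0 *m expo 1 A a) (A + s%:C *: jacobi 1 A B a g).
  rewrite -jacobi_affine //.
  apply: tangent_jacobi => //.
  - by rewrite mulmxDr -scalemxAr AA AB cdiagZ cdiagD.
  - exact: (family_gram AA AB BB s).
  - move=> s'; have -> : A + s'%:C *: (A + s%:C *: B) =
        (1 + s')%:C *: A + (s' * s)%:C *: B; last exact: TAB.
    by rewrite rmorphD rmorphM /= scalerDr scalerA addrA scalerDl scale1r.
(* [expo (-1)] inverts [expo 1]: the second leg ends at [g0] when [s = 0]. *)
have [b' CC] := jacobi_normal AA AB BB 1.
have UE := expo_Unm an0 AA 1.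
have := tangent_jacobi (-1) cgS (UnmM Ug UE) a0 AA (jacobi_gram an0 AA AB 1) CC TC.
by rewrite -mulmxA (expo_invol an0 AA) mulmx1.
Qed.

End Twice.

(** Another frame at the same point, [g diag (Q, 1)], rotates the tangent
    vectors by the isotropy action. *)
Lemma tangent_mulK (S : set (set mat)) (g : mat) (A : 'M[C]_(m, n)) (Q : 'M[C]_n) :
  Unm g -> Q^t* *m Q = 1%:M -> tangent S g A ->
  tangent S (g *m block_mx Q 0 0 1%:M) (A *m Q).
Proof.
move=> Ug QQ [e [c [e0 Sc Uc c0 EA]]].
set k := block_mx Q 0 0 1%:M.
have Uk : UnUm k by apply/UnUmP; exists Q, 1%:M; rewrite ctmx1 mulmx1.
have oU := @open_interval0 R e.
have h0 : `|0 : R| < e by rewrite normr0.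
exists e, (fun s => c s *m k); split.
- exact: e0.
- by apply: smooth_mx_mul => //; exact: smooth_mx_cst.
- move=> s se; have [Us Ss] := Uc s se; split.
    by apply: UnmM => //; apply: UnUm_Unm.
  by rewrite coset_mulK.
- by rewrite c0.
- have Dc := is_mxderive_smooth (1 : R^o) Sc h0.
  rewrite /velocity (mx_derive_val (is_mxderive_mulr k Dc)).
  move: EA; rewrite /velocity c0; set M := mx_derive c 1 0 => EA.
  have [gu _] := Ug; have Uk' := UnUm_Unm Uk; have [ku _] := Uk'.
  have -> : invmx (g *m k) = invmx k *m invmx g.
    have gku : g *m k \in unitmx by rewrite unitmx_mul gu.
    apply: (can_inj (mulKmx gku)).
    by rewrite mulmxV // -mulmxA (mulmxA k) mulmxV // mul1mx mulmxV.
  rewrite -mulmxA (mulmxA (invmx g)); move: EA; set N := invmx g *m M => EA.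
  have ik : invmx k = block_mx (Q^t*) 0 0 1%:M.
    apply: (can_inj (mulKmx ku)); rewrite mulmxV // /k mulmx_block.
    by rewrite !mulmx0 !mul0mx !addr0 !add0r mulmx1 (mulmx1C QQ) -scalar_mx_block.
  rewrite ik /k -[N]submxK !mulmx_block block_mxKdl -EA.
  by rewrite !mul0mx !mulmx0 !add0r !addr0 mul1mx.
Qed.

Lemma diagonalize_gram (B : 'M[C]_(m, n)) : exists (Q : 'M[C]_n) (q : 'I_n -> R),
  Q^t* *m Q = 1%:M /\
  (B *m Q)^t* *m (B *m Q) = cdiag (fun j => (q j ^+ 2)%:C).
Proof.
set H := B^t* *m B.
have Hn : H \is normalmx.
  by apply/normalmxP; rewrite /H ctmxM trmxCK.
have /orthomx_spectralP HE := Hn; set P := spectralmx H in HE.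
have Pu : P \is unitarymx by exact: spectral_unitarymx.
have PP : P *m P^t* = 1%:M by apply/unitarymxP.
pose d := spectral_diag H.
have E : (B *m P^t*)^t* *m (B *m P^t*) = diag_mx d.
  rewrite ctmxM trmxCK mulmxA -(mulmxA P) -/H HE invmx_unitary //.
  by rewrite -!mulmxA PP mulmx1 mulmxA PP mul1mx.
have dge j : 0 <= d 0 j.
  by have := ctmx_mul_diag_ge0 (B *m P^t*) j; rewrite E mxE eqxx.
exists (P^t*), (fun j => Num.sqrt (Re (d 0 j))); split; first by rewrite trmxCK.
rewrite E; congr diag_mx; apply/rowP => j; rewrite mxE.
have := dge j; rewrite lecE /= => /andP[/eqP im0 re0].
by rewrite sqr_sqrtr //; apply: eq_ReIm; rewrite ?cReC ?cImC.
Qed.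

Lemma gram_mul_unitary (A B : 'M[C]_(m, n)) (Q : 'M[C]_n) z :
  Q^t* *m Q = 1%:M -> A^t* *m B = z%:M -> (A *m Q)^t* *m (B *m Q) = z%:M.
Proof.
move=> QQ AB; rewrite ctmxM mulmxA -(mulmxA _ _ B) AB mul_mx_scalar.
by rewrite -scalemxAl QQ scalemx1.
Qed.

Section Necessary.
Variables (S : set (set mat)) (X Y : 'M[C]_(m, n)) (l : R).
Hypothesis cgS : contains_geodesics S.
Hypothesis TS : forall A, tangent S 1%:M A <->
  exists x y : R, A = x%:C *: X + y%:C *: Y.
Hypothesis l0 : 0 < l.
Hypothesis XX : X^t* *m X = (l ^+ 2)%:C%:M.

Lemma tangent_base (Q : 'M[C]_n) (x y : R) : Q^t* *m Q = 1%:M ->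
  tangent S (block_mx Q 0 0 1%:M) (x%:C *: (X *m Q) + y%:C *: (Y *m Q)).
Proof.
move=> QQ; rewrite -[block_mx _ _ _ _]mul1mx !scalemxAl -mulmxDl.
by apply: tangent_mulK => //; [exact: Unm1|apply/TS; exists x, y].
Qed.

Lemma base_tangent (Q : 'M[C]_n) (Z : 'M[C]_(m, n)) : Q^t* *m Q = 1%:M ->
  tangent S (block_mx Q 0 0 1%:M) Z ->
  exists x y : R, Z *m Q^t* = x%:C *: X + y%:C *: Y.
Proof.
move=> QQ TZ; apply/TS.
have Uk : UnUm (block_mx Q 0 0 1%:M : mat).
  by apply/UnUmP; exists Q, 1%:M; rewrite ctmx1 mulmx1.
have := tangent_mulK (UnUm_Unm Uk) _ TZ.
move=> /(_ (Q^t*)); rewrite trmxCK => /(_ (mulmx1C QQ)).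
rewrite mulmx_block !mul0mx !mulmx0 !addr0 !add0r (mulmx1C QQ) mulmx1.
by rewrite -scalar_mx_block.
Qed.

(** With [X^* Y = i nu] scalar, the coefficients of the iterated Jacobi field
    do not depend on the column: it is [- (s^2 Y + s^4 nu (i X))] with
    [s = sh l / l], so that [i X] is in the plane. *)
Lemma necessary_complex (nu : R) : nu != 0 ->
  X^t* *m Y = (Complex 0 nu)%:M ->
  exists x y : R, (Complex 0 1 : C) *: X = x%:C *: X + y%:C *: Y.
Proof.
move=> nu0 XY; have [Q [q [QQ YQ]]] := diagonalize_gram Y.
have QQ' := mulmx1C QQ.
have AA : (X *m Q)^t* *m (X *m Q) = cdiag (fun j : 'I_n => (l ^+ 2)%:C).
  by rewrite cdiag_const; apply: gram_mul_unitary.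
have AB : (X *m Q)^t* *m (Y *m Q) = cdiag (fun j : 'I_n => Complex 0 nu).
  by rewrite cdiag_const; apply: gram_mul_unitary.
have Uk : UnUm (block_mx Q 0 0 1%:M : mat).
  by apply/UnUmP; exists Q, 1%:M; rewrite ctmx1 mulmx1.
have := tangent_jacobi_twice (fun=> l0) AA AB YQ cgS (UnUm_Unm Uk)
  (fun x y => tangent_base x y QQ).
move=> /(base_tangent QQ) [x [y]].
set s := shr 1 l.
rewrite !cdiag_const !mul_mx_scalar /= !mulr0.
rewrite mulNmx mulmxDl -!scalemxAl -!mulmxA QQ' !mulmx1 => E.
have s0 : s != 0.
  by rewrite /s /shr mul1r mulf_neq0 ?invr_eq0 ?gt_eqF// sh_gt0.
pose w := s ^+ 4 * nu.
have w0 : w != 0 by rewrite mulf_neq0 ?expf_neq0.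
exists (- x / w), ((- y - s ^+ 2) / w).
apply: (scalerI (a := w%:C)); first by rewrite fmorph_eq0.
rewrite scalerDr !scalerA -!rmorphM /= !(mulrCA w) mulfV // !mulr1.
have -> : w%:C * Complex 0 1 = Complex 0 w.
  by apply: eq_ReIm; rewrite /= ?mulr0 ?mulr1; ring.
have -> : Complex 0 w *: X = - (x%:C *: X + y%:C *: Y) - (s ^+ 2)%:C *: Y.
  by rewrite -E opprK addrAC addrN add0r.
by rewrite rmorphB !rmorphN /= scalerBl !scaleNr opprD addrA.
Qed.

(** Write [x_j], [y_j] for the columns after diagonalization and [q_j] for the
    length of [y_j].  Column [j] of the iterated Jacobi field of [X] along
    [X + Y] is, up to sign, [s_j x_j + w_j (x_j + y_j)] with [s_j > 1], hence
    [w_j < 0].  As it lies in the plane, comparison of the components along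
    [x_j] and [y_j] shows that [w_j q_j ^ 2] does not depend on [j], nor does
    [w_j] over the [j] with [q_j] nonzero; thus all the [q_j] agree. *)
Lemma necessary_real : Y != 0 -> X^t* *m Y = 0 ->
  exists2 k : R, k != 0 & Y^t* *m Y = (k ^+ 2)%:C%:M.
Proof.
move=> Y0 XY; have [Q [q [QQ YQ]]] := diagonalize_gram Y.
have QQ' := mulmx1C QQ.
pose X1 := X *m Q; pose Y1 := Y *m Q.
have XX1 : X1^t* *m X1 = cdiag (fun j : 'I_n => (l ^+ 2)%:C).
  by rewrite cdiag_const; apply: gram_mul_unitary.
have XY1 : X1^t* *m Y1 = 0.
  by rewrite ctmxM mulmxA -(mulmxA _ _ Y) XY mulmx0 mul0mx.
have YX1 : Y1^t* *m X1 = 0 by rewrite -[X1]trmxCK -ctmxM XY1 ctmx0.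
pose a j := Num.sqrt (l ^+ 2 + q j ^+ 2).
have l2 : 0 < l ^+ 2 by rewrite exprn_gt0.
have pa j : 0 < l ^+ 2 + q j ^+ 2 by rewrite ltr_wpDr// sqr_ge0.
have a0 j : 0 < a j by rewrite sqrtr_gt0.
have a2 j : a j ^+ 2 = l ^+ 2 + q j ^+ 2 by rewrite sqr_sqrtr// ltW.
have AA : (X1 + Y1)^t* *m (X1 + Y1) = cdiag (fun j => (a j ^+ 2)%:C).
  rewrite ctmxD mulmxDl !mulmxDr XX1 XY1 YX1 YQ addr0 add0r cdiagD.
  by apply: cdiag_ext => j; rewrite a2 rmorphD.
have AB : (X1 + Y1)^t* *m X1 = cdiag (fun j : 'I_n => (l ^+ 2)%:C).
  by rewrite ctmxD mulmxDl XX1 YX1 addr0.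
have Uk : UnUm (block_mx Q 0 0 1%:M : mat).
  by apply/UnUmP; exists Q, 1%:M; rewrite ctmx1 mulmx1.
have TAB s t : tangent S (block_mx Q 0 0 1%:M) (s%:C *: (X1 + Y1) + t%:C *: X1).
  have := tangent_base (s + t) s QQ; rewrite -/X1 -/Y1.
  rewrite rmorphD /=; move: (s%:C) (t%:C) X1 Y1 {XX1 XY1 YX1 AA AB} => s' t' U V.
  by rewrite scalerDl scalerDr addrAC.
have := tangent_jacobi_twice a0 AA AB XX1 cgS (UnUm_Unm Uk) TAB.
move=> /(base_tangent QQ) [x [y]].
set s := fun j => shr 1 (a j) ^+ 2.
pose w j := (1 - s j) / a j ^+ 2 * l ^+ 2.
set W := cdiag (fun j => Complex _ (_ * _)).
move=> /(congr1 (mulmx^~ Q)) E; rewrite -mulmxA QQ mulmx1 in E.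
rewrite [RHS]mulmxDl -!scalemxAl -/X1 -/Y1 in E.
have a1 j : a j != 0 by exact: lt0r_neq0.
have w_lt0 j : w j < 0.
  rewrite /w pmulr_llt0// pmulr_llt0 ?invr_gt0 ?exprn_gt0// subr_lt0 /s.
  have s1 : 1 < shr 1 (a j) by rewrite /shr mul1r ltr_pdivlMr// mul1r sh_gt.
  by rewrite expr2 (lt_trans s1)// ltr_pMl// (lt_trans ltr01).
have L (Z : 'M[C]_(m, n)) D : Z^t* *m - (X1 *m D + (X1 + Y1) *m W) =
    - (Z^t* *m X1 *m D + (Z^t* *m X1 + Z^t* *m Y1) *m W).
  move: X1 Y1 {XX1 XY1 YX1 AA AB TAB E YQ} => U V.
  by rewrite mulmxN mulmxDr !mulmxA mulmxDr.
have RR (Z : 'M[C]_(m, n)) : Z^t* *m (x%:C *: X1 + y%:C *: Y1) =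
    x%:C *: (Z^t* *m X1) + y%:C *: (Z^t* *m Y1).
  by rewrite mulmxDr -!scalemxAr.
have WE : W = cdiag (fun j => (w j)%:C).
  apply: cdiag_ext => j.
  by apply: eq_ReIm; rewrite !(cReE, cImE) ?mulr0.
have Ex j : w j * q j ^+ 2 = l ^+ 2 * (1 + x).
  have := congr1 (mulmx (X1^t*)) E.
  rewrite L RR XX1 XY1 WE scaler0 !addr0 !cdiagM cdiagD cdiagN cdiagZ.
  move=> /cdiag_inj /(_ j); rewrite -!rmorphM -rmorphD -rmorphN /= => /complexI.
  rewrite -/(s j) => H.
  have -> : l ^+ 2 * (1 + x) = l ^+ 2 - l ^+ 2 * s j - l ^+ 2 * w j.
    by rewrite mulrDr mulr1 (mulrC _ x) -H; ring.
  by rewrite /w a2; field; rewrite lt0r_neq0.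
have Ey j : q j != 0 -> w j = - y.
  move=> qj; have := congr1 (mulmx (Y1^t*)) E.
  rewrite L RR YX1 YQ WE mul0mx scaler0 !add0r !cdiagM cdiagN cdiagZ.
  move=> /cdiag_inj /(_ j); rewrite -!rmorphM -rmorphN /= => /complexI H.
  apply: (mulfI (expf_neq0 2 qj)); apply: oppr_inj; rewrite H; ring.
have Y1E (c : R) : (forall j, q j ^+ 2 = c) -> Y^t* *m Y = c%:C%:M.
  move=> qc; have -> : Y = Y1 *m Q^t* by rewrite -mulmxA QQ' mulmx1.
  rewrite ctmxM trmxCK mulmxA -(mulmxA Q) YQ (cdiag_ext (g := fun=> c%:C)).
    by rewrite cdiag_const mul_mx_scalar -scalemxAl QQ' scalemx1.
  by move=> j; rewrite qc.
have qn0 j : q j != 0.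
  apply/negP => /eqP qj; move: Y0; case/eqP.
  apply: ctmx_mul_eq0; rewrite (Y1E 0) ?raddf0// => k; apply/eqP.
  have : w k * q k ^+ 2 = 0 by rewrite Ex -(Ex j) qj expr0n mulr0.
  by move=> /eqP; rewrite mulf_eq0 (lt_eqF (w_lt0 k)).
have [j0 _|n0] := pickP 'I_n; last first.
  by move: Y0; rewrite (_ : Y = 0) ?eqxx//; apply/matrixP => i j; have := n0 j.
exists (q j0) => //; apply: Y1E => j.
apply: (mulfI (negbT (lt_eqF (w_lt0 j)))); rewrite Ex -(Ex j0).
by rewrite (Ey j) // (Ey j0).
Qed.

End Necessary.
End Forward.

(** * The model surfaces *)

Section MeanTrace.
Variables (R : realType) (n : nat).
Local Notation C := R[i].

(** A functional, linear over the reals, that reads off [Re z] on [z%:M]. *)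
Definition mean_trace (M : 'M[C]_n) : R := Re (\tr M) / n%:R.

Lemma mean_trace_scalar (z : C) : (0 < n)%N -> mean_trace z%:M = Re z.
Proof.
move=> n0; rewrite /mean_trace mxtrace_scalar (_ : Re (z *+ n) = Re z * n%:R).
  by rewrite mulfK // pnatr_eq0 -lt0n.
by elim: (n) => [|k IH]; rewrite ?mulr0 // mulrSr cReD IH -natr1 mulrDr mulr1.
Qed.

Lemma is_derive_mean_trace (V : normedModType R) (x v : V) (f : V -> 'M[C]_n) M :
  is_mxderive x v f M ->
  is_derive x v (fun y => mean_trace (f y) : R^o) (mean_trace M).
Proof.
move=> Df; have [Dre _] : is_cderive x v (fun y => \tr (f y)) (\tr M).
  by apply: is_cderive_sum => i; apply: Df.
have := is_deriveM Dre (is_derive_cst (n%:R^-1 : R^o) x v).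
move=> H; apply: is_derive_ext H _ _ => //.
by rewrite scaler0 add0r /GRing.scale /= mulrC.
Qed.

Lemma Ck_mean_trace (V : normedModType R) (U : set V) (f : V -> 'M[C]_n) k :
  open U -> smooth_mx U f -> Ck k U (fun y => mean_trace (f y) : R^o).
Proof.
move=> oU Sf; apply: CkM => //; last exact: Ck_cst.
have : csmooth U (fun y => \tr (f y)).
  by apply: csmooth_sum => // i k'; apply: Sf.
by move=> /(_ k)[].
Qed.

Lemma mean_trace_gram_ge0 (p : nat) (B : 'M[C]_(n, p)) :
  0 <= mean_trace (B *m B^t*).
Proof.
rewrite /mean_trace divr_ge0 // /mxtrace cRe_sum sumr_ge0 // => i _.
have := ctmx_mul_diag_ge0 (B^t*) i; rewrite trmxCK lecE => /andP[_].
exact.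
Qed.

End MeanTrace.

Section Model.
Variables (R : realType) (n m : nat).
Local Notation C := R[i].
Local Notation mat := 'M[C]_(n + m).
Variables (E1 E2 : 'M[C]_(m, n)) (kap : R).
Hypothesis n0 : (0 < n)%N.
Hypothesis E11 : E1^t* *m E1 = 1%:M.
Hypothesis E22 : E2^t* *m E2 = 1%:M.
Hypothesis E12 : E1^t* *m E2 = (Complex 0 kap)%:M.
Hypothesis Ekap : kap = 0 \/ E2 = Complex 0 1 *: E1.

Definition plane (x y : R) : 'M[C]_(m, n) := x%:C *: E1 + y%:C *: E2.

Lemma scalar_mx_injn (u v : C) : u%:M = v%:M :> 'M[C]_n -> u = v.
Proof.
move=> /(congr1 (fun M : 'M[C]_n => M (Ordinal n0) (Ordinal n0))).
by rewrite !mxE eqxx.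
Qed.

Lemma plane_gram x y x' y' : (plane x y)^t* *m plane x' y' =
  (Complex (x * x' + y * y') (kap * (x * y' - y * x')))%:M.
Proof.
have E21 : E2^t* *m E1 = (Complex 0 (- kap))%:M.
  have <- : (Complex 0 kap)^* = Complex 0 (- kap) :> C.
    by apply: eq_ReIm; rewrite ?cReJ ?cImJ.
  by rewrite -[E1]trmxCK -ctmxM E12 ctmx_scalar.
rewrite /plane ctmxD !ctmxZ !conjCr mulmxDl !mulmxDr -!scalemxAl -!scalemxAr.
rewrite E11 E12 E21 E22 !scale_scalar_mx -!raddfD /=; congr (_%:M).
by apply: eq_ReIm; rewrite !(cReD, cImD, cReM, cImM, cReE, cImE); ring.
Qed.

Lemma plane_norm x y : (plane x y)^t* *m plane x y = (x ^+ 2 + y ^+ 2)%:C%:M.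
Proof.
rewrite plane_gram; congr (_%:M).
by apply: eq_ReIm; rewrite !(cReE, cImE) //; ring.
Qed.

Lemma planeD x y x' y' : plane x y + plane x' y' = plane (x + x') (y + y').
Proof. by rewrite /plane !rmorphD /= !scalerDl addrACA. Qed.

Lemma planeZ a x y : a%:C *: plane x y = plane (a * x) (a * y).
Proof. by rewrite /plane scalerDr !scalerA !rmorphM. Qed.

Lemma plane_eq0 x y : plane x y = 0 -> x = 0 /\ y = 0.
Proof.
move=> Z0; have := plane_norm x y; rewrite Z0 mulmx0 => /esym.
rewrite -(raddf0 (@scalar_mx C n)) => /scalar_mx_injn /complexI /eqP.
by rewrite paddr_eq0 ?sqr_ge0// !sqrf_eq0 => /andP[/eqP -> /eqP ->].
Qed.

(** The scalars occurring as Gram products of the plane stabilize it. *)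
Lemma plane_stable (u v x y : R) :
  exists x' y', Complex u (kap * v) *: plane x y = plane x' y'.
Proof.
case: Ekap => [->|E2E].
  exists (u * x), (u * y); rewrite -planeZ; congr (_ *: _).
  by rewrite mul0r.
exists (u * x - kap * v * y), (u * y + kap * v * x).
rewrite /plane E2E !scalerA -!scalerDl scalerA; congr (_ *: _).
by apply: eq_ReIm; rewrite !(cReD, cImD, cReM, cImM, cReE, cImE); ring.
Qed.

Definition rho (x y : R) : R := Num.sqrt (1 + x ^+ 2 + y ^+ 2).

Lemma rho_gt0 x y : 0 < rho x y.
Proof. by rewrite sqrtr_gt0 -addrA ltr_pwDl// addr_ge0 ?sqr_ge0. Qed.

Lemma rho_sqr x y : rho x y ^+ 2 = 1 + x ^+ 2 + y ^+ 2.
Proof. by rewrite sqr_sqrtr // -addrA addr_ge0// addr_ge0 ?sqr_ge0. Qed.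

(** A section of the projection to D, above the plane: writing Z for
    [plane x y], this is the positive definite element of U(n,m) with lower left
    block Z.  It is smooth because [Z^* Z] is scalar, which gives
    [sqrt (1 + Z Z^* ) = 1 + Z Z^* / (1 + rho)]. *)
Definition frame (x y : R) : mat :=
  block_mx (rho x y)%:C%:M ((plane x y)^t*) (plane x y)
    (1%:M + ((1 + rho x y)^-1)%:C *: (plane x y *m (plane x y)^t*)).

Lemma frame_Unm x y : Unm (frame x y).
Proof.
have r0 := rho_gt0 x y; have r1 : 1 + rho x y != 0 by rewrite gt_eqF// addr_gt0.
have zr : x ^+ 2 + y ^+ 2 = rho x y ^+ 2 - 1 by rewrite rho_sqr; ring.
have N := plane_norm x y.
apply/Unm_blockP; split.
- rewrite ctmx_scalar conjCr -scalar_mxM N zr -raddfD /=; congr (_%:M).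
  by rewrite -rmorphM -(rmorph1 (real_complex R)) -rmorphD; congr (_%:C); ring.
- rewrite ctmx_scalar conjCr mul_scalar_mx mulmxDr mulmx1 -scalemxAr mulmxA N zr.
  rewrite mul_scalar_mx scalerA -[X in X + _]scale1r -scalerDl; congr (_ *: _).
  rewrite -(rmorph1 (real_complex R)) -rmorphM -rmorphD /=; congr (_%:C).
  by field.
- rewrite ctmxD ctmx1 ctmxZ conjCr ctmxM trmxCK mulmxDl mul1mx mulmxDr mulmx1.
  rewrite -addrA; congr (_ + _).
  rewrite -scalemxAr -scalemxAl mulmxA -(mulmxA _ _ (plane x y)).
  rewrite N zr mul_mx_scalar -scalemxAl !scalerA -!scalerDl -[RHS]scale1r.
  congr (_ *: _); rewrite -(rmorph1 (real_complex R)) -!rmorphM -!rmorphD /=.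
  by congr (_%:C); field.
Qed.

Definition surface : set (set mat) := [set p | exists x y, p = coset (frame x y)].

Lemma Unm_block_diag (k : mat) : Unm k -> dlsubmx k = 0 -> UnUm k.
Proof.
rewrite -{1}[k]submxK => Uk k0; rewrite k0 in Uk.
have au := Unm_a_unit Uk; have [aa ab dd] := (Unm_blockP _ _ _ _).1 Uk.
rewrite ctmx0 !mul0mx ?addr0 in aa ab.
have au' : (ulsubmx k)^t* \in unitmx by rewrite map_unitmx unitmx_tr.
have b0 : ursubmx k = 0 by rewrite -[ursubmx k](mulKmx au') ab mulmx0.
apply/UnUmP; exists (ulsubmx k), (drsubmx k); split=> //.
  by rewrite dd b0 mulmx0 addr0.
by rewrite -{1}[k]submxK k0 b0.
Qed.

(** [a^* (1 - W^* W) a = 1] and [W^* W] is scalar, so [a] is a multiple of a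
    unitary matrix. *)
Lemma disc_scalar (a : 'M[C]_n) b c (d : 'M[C]_m) w1 w2 :
  Unm (block_mx a b c d) -> c = plane w1 w2 *m a ->
  exists r, [/\ 0 < r, r ^+ 2 * (1 - (w1 ^+ 2 + w2 ^+ 2)) = 1,
    a^t* *m a = (r ^+ 2)%:C%:M & a *m a^t* = (r ^+ 2)%:C%:M].
Proof.
move=> Ug cW; have [aa _ _] := (Unm_blockP _ _ _ _).1 Ug.
set w := w1 ^+ 2 + w2 ^+ 2.
have E : (1 - w)%:C *: (a^t* *m a) = 1%:M.
  rewrite rmorphB rmorph1 scalerBl scale1r {1}aa cW ctmxM mulmxA.
  by rewrite -(mulmxA _ _ (plane _ _)) plane_norm mul_mx_scalar -scalemxAl addrK.
have w1_gt0 : 0 < 1 - w.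
  pose j0 := Ordinal n0; have := congr1 (fun M : 'M[C]_n => M j0 j0) E.
  rewrite mxE [RHS]mxE eqxx => Ej; have := ctmx_mul_diag_ge0 a j0.
  rewrite lecE => /andP[/eqP im0 re0].
  have := congr1 (@complex.Re R) Ej; rewrite cReM cReC cImC mul0r subr0 => Er.
  rewrite ltNge; apply/negP => wle; move: (mulr_le0_ge0 wle re0); rewrite Er.
  by rewrite ler10.
pose r := Num.sqrt ((1 - w)^-1).
have r2 : r ^+ 2 = (1 - w)^-1 by rewrite sqr_sqrtr// invr_ge0 ltW.
have aE : a^t* *m a = (r ^+ 2)%:C%:M.
  apply: (scalerI (a := (1 - w)%:C)); first by rewrite fmorph_eq0 gt_eqF.
  by rewrite E r2 scale_scalar_mx -rmorphM /= mulfV ?gt_eqF.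
exists r; split=> //; first by rewrite sqrtr_gt0 invr_gt0.
  by rewrite r2 mulVf ?gt_eqF.
have r20 : (r ^+ 2)%:C != 0 by rewrite fmorph_eq0 r2 invr_eq0 gt_eqF.
have : ((r ^+ 2)%:C^-1 *: a^t*) *m a = 1%:M.
  by rewrite -scalemxAl aE scale_scalar_mx mulVf.
move=> /mulmx1C; rewrite -scalemxAr => /(congr1 ( *:%R (r ^+ 2)%:C)).
by rewrite scalerA mulfV // scale1r scalemx1.
Qed.

(** In the bounded realization of D by [c a^-1] the surface is a linear slice;
    that [W] lies in the unit ball follows from [g] being in U(n,m). *)
Lemma surfaceP g : Unm g ->
  surface (coset g) <-> exists w1 w2, dlsubmx g = plane w1 w2 *m ulsubmx g.
Proof.
move=> Ug; split.
  move=> [x [y /coset_eqP [k /UnUmP[A [B [AA BB ->]]] ->]]].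
  exists (x / rho x y), (y / rho x y).
  rewrite /frame mulmx_block block_mxKdl block_mxKul !mulmx0 !addr0.
  rewrite mul_scalar_mx -scalemxAr scalemxAl planeZ.
  by rewrite !(mulrC (rho x y)) !divfK // gt_eqF ?rho_gt0.
move=> [w1 [w2 cW]]; have Ug' := Ug; rewrite -[g]submxK in Ug'.
have [r [r0 rw _ _]] := disc_scalar Ug' cW.
exists (r * w1), (r * w2); apply/coset_eqP.
have UF := frame_Unm (r * w1) (r * w2); have [Fu _] := UF.
have rhoE : rho (r * w1) (r * w2) = r.
  rewrite /rho (_ : 1 + _ + _ = r ^+ 2); first by rewrite sqrtr_sqr gtr0_norm.
  by rewrite -{1}rw; ring.
exists (invmx (frame (r * w1) (r * w2)) *m g); last by rewrite mulKVmx.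
apply: Unm_block_diag; first by apply: UnmM => //; apply: UnmV.
rewrite (Unm_inv UF) /frame rhoE ctmx_block /Lambda !mulmx_block.
rewrite -{1}[g]submxK mulmx_block block_mxKdl.
rewrite !mulmx0 !mul0mx !addr0 !add0r !mulmxN !mulmx1 !mul1mx.
rewrite trmxCK -planeZ; have := plane_norm w1 w2; move: cW.
move: (plane w1 w2) => W cW N.
rewrite ctmxD ctmx1 ctmxZ conjCr ctmxM trmxCK cW.
have E : (r%:C *: W) *m (r%:C *: W)^t* *m W = (r ^+ 2 - 1)%:C *: W.
  rewrite ctmxZ conjCr -scalemxAr -!scalemxAl -mulmxA N mul_mx_scalar !scalerA.
  by rewrite -!rmorphM /=; congr (_%:C *: _); rewrite -rw; ring.
rewrite mulmxA mulmxDl mul1mx -scalemxAl E scalerA -rmorphM /=.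
have -> : (1 + r)^-1 * (r ^+ 2 - 1) = r - 1.
  by field; rewrite gt_eqF// addr_gt0.
by rewrite rmorphB rmorph1 scalerBl scale1r addrCA subrr addr0 mulNmx addNr.
Qed.

(** The hypothesis on [A] says that P is the derivative of [c a^-1] up to the
    scalar [a^* a].  It gives [A = d^* P a], whence [A^* A] is a scalar [s ^ 2]
    and [exp (t hat A)] is known.  With [W^* P = ka] one finds, at time [t],
    [a_t = (ch + r^2 ka sh / s) a] and [c_t = W a_t + (sh / s) P a], so that
    [c_t a_t^-1] is [W] plus a multiple of [P] by a scalar stabilizing the
    plane. *)
Lemma geodesic_in_surface g A c w1 w2 p1 p2 : Unm g ->
  geodesic_lift A c -> c 0 = g ->
  dlsubmx g = plane w1 w2 *m ulsubmx g ->
  (drsubmx g - plane w1 w2 *m ursubmx g) *m A = plane p1 p2 *m ulsubmx g ->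
  forall t, surface (coset (c t)).
Proof.
move=> Ug Lc c0 cW PA t; have Ug' := Ug; rewrite -[g]submxK in Ug'.
have au := Unm_a_unit Ug'.
have [r [r0 rw aa1 aa2]] := disc_scalar Ug' cW.
have [_ ab dd] := (Unm_blockP _ _ _ _).1 Ug'.
have [_ ac' dd'] := Unm_blockP' Ug'.
set ka := Complex (w1 * p1 + w2 * p2) (kap * (w1 * p2 - w2 * p1)).
have WP : (plane w1 w2)^t* *m plane p1 p2 = ka%:M by exact: plane_gram.
have PP := plane_norm p1 p2.
have PW : (plane p1 p2)^t* *m plane w1 w2 = (ka^*)%:M.
  by rewrite -ctmx_scalar -WP ctmxM trmxCK.
have stab u v := plane_stable u v p1 p2.
have sW := (surfaceP Ug).2 (ex_intro _ w1 (ex_intro _ w2 cW)).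
have combine z : exists v1 v2, plane w1 w2 + (Complex (Re z) (kap * Im z)) *: plane p1 p2
    = plane v1 v2.
  by have [x [y ->]] := stab (Re z) (Im z); rewrite planeD; do 2 eexists.
move: combine stab WP PP PW cW PA; move: (plane w1 w2) (plane p1 p2) => W P.
move=> combine stab WP PP PW cW PA.
move: (ulsubmx g) (ursubmx g) (dlsubmx g) (drsubmx g) (submxK g) au aa1 aa2 ab dd
  ac' dd' cW PA Ug' => a b e d gE au aa1 aa2 ab dd ac' dd' cW PA Ug'.
have dW : d^t* *m W = b^t*.
  apply: (can_inj (mulmxK au)); rewrite -mulmxA -cW.
  by rewrite -[e]trmxCK -ctmxM -ab ctmxM trmxCK.
have AE : A = d^t* *m P *m a.
  by rewrite -mulmxA -PA mulmxA mulmxBr mulmxA dW dd addrK mul1mx.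
have bA : b *m A = ((r ^+ 2)%:C * ka) *: a.
  rewrite AE !mulmxA -ac' cW ctmxM !mulmxA aa2 -!mulmxA (mulmxA _ P) WP.
  by rewrite mul_scalar_mx mul_scalar_mx scalerA.
have dA : d *m A = P *m a + ((r ^+ 2)%:C * ka) *: (W *m a).
  rewrite AE !mulmxA dd' mulmxDl mul1mx mulmxDl; congr (_ + _).
  rewrite cW ctmxM -!mulmxA (mulmxA a) aa2 (mulmxA _ P) WP.
  by rewrite !mul_scalar_mx !scalemxAr scalerA -scalemxAr.
pose q : R := r ^+ 2 * (p1 ^+ 2 + p2 ^+ 2 +
  r ^+ 2 * ((w1 * p1 + w2 * p2) ^+ 2 + (kap * (w1 * p2 - w2 * p1)) ^+ 2)).
have q0 : 0 <= q.
  rewrite mulr_ge0 ?sqr_ge0// addr_ge0// ?addr_ge0 ?sqr_ge0//.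
  by rewrite mulr_ge0 ?sqr_ge0// addr_ge0 ?sqr_ge0.
have AA : A^t* *m A = q%:C%:M.
  rewrite {1}AE !ctmxM trmxCK -!mulmxA dA mulmxDr -scalemxAr !mulmxA.
  rewrite PP PW !mul_scalar_mx scalerA -scalerDl -scalemxAr aa1 scale_scalar_mx.
  congr (_%:M).
  by apply: eq_ReIm; rewrite !(cReD, cImD, cReM, cImM, cReJ, cImJ, cReE, cImE) /q; ring.
(* [expo] needs nonzero radii: the constant geodesic is treated apart. *)
have [q00|qn0] := eqVneq q 0.
  have A0 : A = 0 by apply: ctmx_mul_eq0; rewrite AA q00 raddf0.
  have Lg : geodesic_lift A (fun=> g).
    split=> // [|s]; first exact: smooth_mx_cst.
    rewrite A0 /hat ctmx0 (_ : block_mx _ _ _ _ = 0); last exact: block_mx0.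
    by rewrite mulmx0; apply: mx_derive_val; apply: is_mxderive_cst.
  by rewrite (geodesic_lift_unique Lc Lg).
pose s := Num.sqrt q.
have s0 : s != 0 by rewrite gt_eqF // sqrtr_gt0 lt_neqAle eq_sym qn0.
have s2 : s ^+ 2 = q by rewrite sqr_sqrtr.
have AAs : A^t* *m A = cdiag (fun j : 'I_n => (s ^+ 2)%:C) by rewrite cdiag_const s2.
have Le := geodesic_lift_left Ug (expo_lift (fun=> s0) AAs).
have cE : c t = g *m expo t A (fun=> s).
  by apply: (geodesic_lift_unique Lc Le); rewrite c0 expo0 mulmx1.
have Uc : Unm (c t) by case: Lc.
apply/(surfaceP Uc); rewrite cE -gE /expo !cdiag_const mulmx_block.
rewrite block_mxKdl block_mxKul !mul_mx_scalar.
set ct := (ch _)%:C; set st := shr _ _.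
rewrite -!scalemxAr bA dA scalerA -scalerDl; set h := ct + _.
have UE := expo_Unm (fun=> s0) AAs t.
have hu : h *: a \in unitmx.
  have := UnmM Ug UE; rewrite -gE /expo !cdiag_const mulmx_block.
  move=> /Unm_a_unit; rewrite !mul_mx_scalar -!scalemxAr bA scalerA.
  by rewrite -scalerDl.
have h0 : h != 0.
  apply/eqP => h0; have := mulmxV hu; rewrite h0 scale0r mul0mx.
  by rewrite -(raddf0 (@scalar_mx C n)) => /scalar_mx_injn /eqP; rewrite eq_sym oner_eq0.
have hi : Im h = st * r ^+ 2 * (kap * (w1 * p2 - w2 * p1)).
  by rewrite /h !(cImD, cImM, cReM, cReE, cImE); ring.
have hE : h = ct + st%:C * ((r ^+ 2)%:C * ka) by [].
clearbody h; pose N := Re h ^+ 2 + Im h ^+ 2.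
have N0 : N != 0.
  apply: contra h0; rewrite paddr_eq0 ?sqr_ge0// !sqrf_eq0 => /andP[/eqP hr /eqP hi0].
  by apply/eqP; apply: eq_ReIm.
(* [st / h], written so that its imaginary part is visibly a multiple of kap *)
pose Z := Complex (st * Re h / N) (- (st ^+ 2 * r ^+ 2 * (w1 * p2 - w2 * p1)) / N).
have [v1 [v2 vE]] := combine Z.
exists v1, v2; rewrite -vE mulmxDl -!scalemxAr -scalemxAl scalerA.
have -> : h * Complex (Re Z) (kap * Im Z) = st%:C.
  apply: eq_ReIm; rewrite !(cReM, cImM, cReE, cImE, cReC, cImC).
    transitivity (st * (Re h ^+ 2 +
      (st * r ^+ 2 * (kap * (w1 * p2 - w2 * p1))) ^+ 2) / N).
      by rewrite hi; ring.
    by rewrite -hi mulfK.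
  by rewrite hi; ring.
rewrite cW; move: (W *m a) (P *m a) => U V.
by rewrite scalerDr scalerA addrA addrAC -scalerDl -hE.
Qed.

Lemma plane_coord1 x y : mean_trace (E1^t* *m plane x y) = x.
Proof.
have -> : E1 = plane 1 0 by rewrite /plane rmorph1 scale1r rmorph0 scale0r addr0.
by rewrite plane_gram mean_trace_scalar // cReE mul1r mul0r addr0.
Qed.

Lemma plane_coord2 x y : mean_trace (E2^t* *m plane x y) = y.
Proof.
have -> : E2 = plane 0 1 by rewrite /plane rmorph1 scale1r rmorph0 scale0r add0r.
by rewrite plane_gram mean_trace_scalar // cReE mul1r mul0r add0r.
Qed.

(** On the surface [a a^*] is a real scalar and [c a^*] lies in the plane, so
    the same holds for their derivatives; then [c' = W a' + P a] with P in the
    plane by the product rule. *)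
Lemma tangent_surface g A : Unm g -> tangent surface g A ->
  exists w1 w2 p1 p2, dlsubmx g = plane w1 w2 *m ulsubmx g /\
    (drsubmx g - plane w1 w2 *m ursubmx g) *m A = plane p1 p2 *m ulsubmx g.
Proof.
move=> Ug [e [c [e0 Sc Uc c0 EA]]]; subst g.
have h0 : `|0 : R| < e by rewrite normr0.
have slice t : `|t| < e -> exists r w1 w2, [/\ 0 < r,
    dlsubmx (c t) = plane w1 w2 *m ulsubmx (c t),
    (ulsubmx (c t))^t* *m ulsubmx (c t) = (r ^+ 2)%:C%:M &
    ulsubmx (c t) *m (ulsubmx (c t))^t* = (r ^+ 2)%:C%:M].
  move=> te; have [Ut St] := Uc t te.
  have [w1 [w2 cW]] := (surfaceP Ut).1 St.
  have Ut' := Ut; rewrite -[c t]submxK in Ut'.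
  by have [r [r0 _ a1 a2]] := disc_scalar Ut' cW; exists r, w1, w2.
have Dc := is_mxderive_smooth (1 : R^o) Sc h0.
have Da := is_mxderive_ulsub Dc; have De := is_mxderive_dlsub Dc.
pose N t := dlsubmx (c t) *m (ulsubmx (c t))^t*.
pose T t := ulsubmx (c t) *m (ulsubmx (c t))^t*.
have DN : is_mxderive (0 : R^o) (1 : R^o) N _ :=
  is_mxderive_mul De (is_mxderive_adj Da).
have DT : is_mxderive (0 : R^o) (1 : R^o) T _ :=
  is_mxderive_mul Da (is_mxderive_adj Da).
have [n1 [n2 NE]] : exists n1 n2,
    dlsubmx (mx_derive c 1 0) *m (ulsubmx (c 0))^t* +
    dlsubmx (c 0) *m (ulsubmx (mx_derive c 1 0))^t* = plane n1 n2.
  have NP t : `|t| < e -> N t =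
      plane (mean_trace (E1^t* *m N t)) (mean_trace (E2^t* *m N t)).
    move=> /slice [r [w1 [w2 [_ cW _ aa]]]].
    have -> : N t = plane (r ^+ 2 * w1) (r ^+ 2 * w2).
      by rewrite /N cW -mulmxA aa mul_mx_scalar planeZ.
    by rewrite plane_coord1 plane_coord2.
  have DP := is_mxderiveD
    (is_mxderive_scale E1 (is_derive_mean_trace (is_mxderive_mull (E1^t*) DN)))
    (is_mxderive_scale E2 (is_derive_mean_trace (is_mxderive_mull (E2^t*) DN))).
  do 2 eexists; exact: is_mxderive_unique (is_mxderive_near e0 NP DN) DP.
have [sg TE] : exists sg : R,
    ulsubmx (mx_derive c 1 0) *m (ulsubmx (c 0))^t* +
    ulsubmx (c 0) *m (ulsubmx (mx_derive c 1 0))^t* = sg%:C%:M.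
  have TP t : `|t| < e -> T t = (mean_trace (T t))%:C *: 1%:M.
    move=> /slice [r [w1 [w2 [_ _ _ aa]]]].
    by rewrite /T aa mean_trace_scalar // cReC scale_scalar_mx mulr1.
  have DP := is_mxderive_scale (1%:M : 'M[C]_n) (is_derive_mean_trace DT).
  eexists; rewrite -scalemx1.
  exact: is_mxderive_unique (is_mxderive_near e0 TP DT) DP.
have [r [w1 [w2 [r0 cW aa1 aa2]]]] := slice 0 h0.
exists w1, w2, ((n1 - sg * w1) / r ^+ 2), ((n2 - sg * w2) / r ^+ 2).
split; first exact: cW.
have [gu _] := Ug; move: EA; rewrite /velocity; set G := mx_derive c 1 0 in NE TE *.
move=> EA.
have GE : G = c 0 *m (invmx (c 0) *m G) by rewrite mulKVmx.
move: (c 0) Ug gu cW aa1 aa2 NE TE EA GE => g Ug gu cW aa1 aa2 NE TE.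
move: (invmx g *m G) => M EA GE.
have aE : ulsubmx G = ulsubmx g *m ulsubmx M + ursubmx g *m A.
  by rewrite GE -{1}[g]submxK -{1}[M]submxK mulmx_block block_mxKul EA.
have eE : dlsubmx G = dlsubmx g *m ulsubmx M + drsubmx g *m A.
  by rewrite GE -{1}[g]submxK -{1}[M]submxK mulmx_block block_mxKdl EA.
have rn0 : r != 0 by rewrite gt_eqF.
have r20 : r ^+ 2 != 0 by rewrite expf_neq0.
apply: (scalerI (a := (r ^+ 2)%:C)); first by rewrite fmorph_eq0.
have PE : (r ^+ 2)%:C *: plane ((n1 - sg * w1) / r ^+ 2) ((n2 - sg * w2) / r ^+ 2) =
    plane n1 n2 - sg%:C *: plane w1 w2.
  have -> : - (sg%:C *: plane w1 w2) = plane (- sg * w1) (- sg * w2).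
    by rewrite -planeZ rmorphN scaleNr.
  by rewrite planeZ planeD; congr plane; field.
rewrite [RHS]scalemxAl PE.
rewrite -NE -[sg%:C *: _]mul_mx_scalar -TE cW.
have -> : (drsubmx g - plane w1 w2 *m ursubmx g) *m A =
    dlsubmx G - plane w1 w2 *m ulsubmx G.
  by rewrite aE eE cW mulmxBl mulmxDr !mulmxA opprD addrACA subrr add0r.
rewrite mulmxDr !mulmxA opprD addrACA subrr addr0 -mulmxBl.
by rewrite -mulmxA aa1 mul_mx_scalar.
Qed.

Lemma plane_smooth (V : normedModType R) (U : set V) (x y : V -> R^o) :
  open U -> (forall k, Ck k U x) -> (forall k, Ck k U y) ->
  smooth_mx U (fun v => plane (x v) (y v)).
Proof. by move=> oU Cx Cy; apply: smooth_mxD => //; apply: smooth_mx_scale. Qed.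

Lemma Ck_rho (V : normedModType R) (U : set V) (x y : V -> R^o) k :
  open U -> Ck k U x -> Ck k U y -> Ck k U (fun v => rho (x v) (y v) : R^o).
Proof.
move=> oU Cx Cy; apply: Ck_sqrt => // [v _|].
  by rewrite -addrA ltr_pwDl// addr_ge0 ?sqr_ge0.
apply: (@Ck_ext _ _ _ _ (fun v => 1 + x v * x v + y v * y v)) => //.
by do !apply: CkD => //; try (apply: CkM => //); apply: Ck_cst.
Qed.

Lemma frame_smooth (V : normedModType R) (U : set V) (x y : V -> R^o) :
  open U -> (forall k, Ck k U x) -> (forall k, Ck k U y) ->
  smooth_mx U (fun v => frame (x v) (y v)).
Proof.
move=> oU Cx Cy; have CZ := plane_smooth oU Cx Cy.
have Cr k : Ck k U (fun v => rho (x v) (y v) : R^o) by apply: Ck_rho.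
have Cth k : Ck k U (fun v => (1 + rho (x v) (y v))^-1 : R^o).
  apply: CkV => // [v _|]; first by rewrite gt_eqF// addr_gt0// rho_gt0.
  by apply: CkD => //; apply: Ck_cst.
apply: smooth_mx_block.
- apply: smooth_mx_eq (smooth_mx_scale oU 1%:M Cr) _ => v.
  by rewrite scalemx1.
- exact: smooth_mx_adj.
- exact: CZ.
- apply: smooth_mxD; [exact: oU|exact: smooth_mx_cst|].
  apply: smooth_mx_eq (smooth_mx_mul oU (smooth_mx_scale oU 1%:M Cth)
    (smooth_mx_mul oU CZ (smooth_mx_adj oU CZ))) _ => v.
  by rewrite -scalemxAl mul1mx.
Qed.

Lemma frame_velocity (V : normedModType R) (x y : V -> R^o) p v (dx dy : R) :
  is_derive p v x dx -> is_derive p v y dy ->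
  velocity (fun q => frame (x q) (y q)) v p =
  plane dx dy +
    (Complex ((1 + rho (x p) (y p))^-1 * (x p * dx + y p * dy)
              - (x p * dx + y p * dy) / rho (x p) (y p))
       ((1 + rho (x p) (y p))^-1 * (kap * (x p * dy - y p * dx))))
     *: plane (x p) (y p).
Proof.
move=> Dx Dy; set xp := x p; set yp := y p.
have Dr : is_derive p v (fun q => rho (x q) (y q) : R^o)
    ((xp * dx + yp * dy) / rho xp yp).
  have Ds := is_deriveD (is_deriveD (is_derive_cst (1 : R^o) p v)
    (is_deriveM Dx Dx)) (is_deriveM Dy Dy).
  have s0 : 0 < 1 + xp * xp + yp * yp.
    by rewrite -addrA ltr_pwDl// addr_ge0// -expr2 sqr_ge0.
  have := @is_derive_comp R V Num.sqrt (fun q => 1 + x q * x q + y q * y q) p v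
    _ _ (is_derive1_sqrt s0) Ds.
  move=> H; apply: is_derive_ext H _ _ => [q|]; first by rewrite /rho !expr2.
  rewrite /rho !expr2 -/xp -/yp /GRing.scale /=.
  have r0 : Num.sqrt (1 + xp * xp + yp * yp) != 0 by rewrite gt_eqF// sqrtr_gt0.
  by field.
have DZ : is_mxderive p v (fun q => plane (x q) (y q)) (plane dx dy).
  by apply: is_mxderiveD; apply: is_mxderive_scale.
rewrite (@velocityE _ _ _ _ _ _ _ ((xp * dx + yp * dy) / rho xp yp)%:C%:M
  (plane dx dy)); first last.
- by apply: is_mxderive_eq DZ _ _ => // q; rewrite block_mxKdl.
- apply: is_mxderive_eq (is_mxderive_scale 1%:M Dr) _ _ => [q|].
    by rewrite block_mxKul scalemx1.
  by rewrite scalemx1.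
- exact: frame_Unm.
have G := plane_gram xp yp dx dy.
rewrite block_mxKdr block_mxKur -/xp -/yp trmxCK mul_mx_scalar.
move: (plane xp yp) (plane dx dy) G => Z P G.
rewrite ctmxD ctmx1 ctmxZ conjCr ctmxM trmxCK mulmxDl mul1mx -addrA.
congr (_ + _); rewrite -scalemxAl -mulmxA G mul_mx_scalar scalerA -scalerBl.
congr (_ *: _); apply: eq_ReIm.
  by rewrite !(cReD, cReN, cReM, cReE, cImE); ring.
by rewrite !(cImD, cImN, cImM, cReE, cImE); ring.
Qed.

(** On [frame x y] the product [c a^*] is [rho Z] and [1 + b b^*] has mean
    trace [rho ^ 2].  These products only depend on the coset, and the
    denominator never vanishes, so this extends the coordinates of the surface
    continuously to all matrices. *)
Definition slice_coord (E : 'M[C]_(m, n)) (g : mat) : R :=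
  mean_trace (E^t* *m (dlsubmx g *m (ulsubmx g)^t*)) /
  Num.sqrt (1 + mean_trace (ursubmx g *m (ursubmx g)^t*)).

Lemma slice_coord_mulK E g k : UnUm k -> slice_coord E (g *m k) = slice_coord E g.
Proof.
move=> /UnUmP[A [B [AA BB ->]]]; rewrite -{1}[g]submxK mulmx_block.
rewrite /slice_coord block_mxKdl block_mxKul block_mxKur.
rewrite !mulmx0 !addr0 !add0r !ctmxM.
rewrite (mulmxA _ (A^t*)) -(mulmxA _ A) (mulmx1C AA) mulmx1.
by rewrite (mulmxA _ (B^t*)) -(mulmxA _ B) (mulmx1C BB) mulmx1.
Qed.

Lemma frame_gram_sqrt x y :
  Num.sqrt (1 + mean_trace (ursubmx (frame x y) *m (ursubmx (frame x y))^t*)) =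
  rho x y.
Proof.
by rewrite block_mxKur trmxCK plane_norm mean_trace_scalar // cReC addrA.
Qed.

Lemma frame_corner x y : dlsubmx (frame x y) *m (ulsubmx (frame x y))^t* =
  plane (rho x y * x) (rho x y * y).
Proof.
by rewrite block_mxKdl block_mxKul ctmx_scalar conjCr mul_mx_scalar planeZ.
Qed.

Lemma coord1_frame x y : slice_coord E1 (frame x y) = x.
Proof.
rewrite /slice_coord frame_gram_sqrt frame_corner plane_coord1.
by rewrite mulrC mulKf // gt_eqF// rho_gt0.
Qed.

Lemma coord2_frame x y : slice_coord E2 (frame x y) = y.
Proof.
rewrite /slice_coord frame_gram_sqrt frame_corner plane_coord2.
by rewrite mulrC mulKf // gt_eqF// rho_gt0.
Qed.

Lemma frame_inj x y x' y' : coset (frame x y) = coset (frame x' y') ->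
  x = x' /\ y = y'.
Proof.
move=> /coset_eqP[k Uk E]; split.
  by rewrite -(coord1_frame x y) E slice_coord_mulK // coord1_frame.
by rewrite -(coord2_frame x y) E slice_coord_mulK // coord2_frame.
Qed.

(** Pairing a vanishing velocity with the plane itself first kills the
    derivative [s / r] of [rho], then the symplectic part [d], and finally the
    derivative of Z. *)
Lemma frame_immersion (V : normedModType R) (x y : V -> R^o) p v (dx dy : R) :
  is_derive p v x dx -> is_derive p v y dy ->
  velocity (fun q => frame (x q) (y q)) v p = 0 -> dx = 0 /\ dy = 0.
Proof.
move=> Dx Dy; rewrite (frame_velocity Dx Dy); move: (x p) (y p) => {Dx Dy} xp yp.
set r := rho xp yp; set s := xp * dx + yp * dy; set z := Complex _ _ => E.
have r0 : 0 < r by exact: rho_gt0.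
have rn0 : r != 0 by rewrite gt_eqF.
have r1 : 1 + r != 0 by rewrite gt_eqF// addr_gt0.
have zr : xp ^+ 2 + yp ^+ 2 = r ^+ 2 - 1 by rewrite rho_sqr; ring.
have := congr1 (mulmx ((plane xp yp)^t*)) E.
rewrite mulmx0 mulmxDr -scalemxAr plane_norm plane_gram scale_scalar_mx -raddfD /=.
rewrite zr -(raddf0 (@scalar_mx C n)) => /scalar_mx_injn.
have -> : xp * dx + yp * dy = s by [].
set d := kap * _ => Ez.
have := congr1 (@complex.Re R) Ez; have := congr1 (@complex.Im R) Ez.
rewrite !(cReD, cImD, cReM, cImM, cReE, cImE) -/d => Ei Er.
have s0 : s = 0.
  transitivity (r * (s + (((1 + r)^-1 * s - s / r) * (r ^+ 2 - 1)
     - (1 + r)^-1 * d * 0)) ); last by rewrite Er mulr0.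
  by field; apply/andP; split.
have d0 : d = 0.
  transitivity (r^-1 * (d + (((1 + r)^-1 * s - s / r) * 0
     + (1 + r)^-1 * d * (r ^+ 2 - 1)))); last by rewrite Ei mulr0.
  by field; apply/andP; split.
apply: plane_eq0; rewrite -[RHS]E (_ : z = 0) ?scale0r ?addr0 //.
by apply: eq_ReIm; rewrite /z ?(cReE, cImE) -/d ?d0 ?s0 ?mulr0 ?mul0r ?subr0.
Qed.

Definition cplx (pq : 'M[R]_(n + m) * 'M[R]_(n + m)) : mat :=
  \matrix_(i, j) Complex (pq.1 i j) (pq.2 i j).

Lemma cplx_smooth : smooth_mx setT cplx.
Proof.
have oT : open [set: 'M[R]_(n + m) * 'M[R]_(n + m)] by exact: openT.
move=> i j k; split.
  apply: (@Ck_ext _ _ k setT (fun pq : 'M[R]_(n + m) * 'M[R]_(n + m) => pq.1 i j)) => //.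
    by move=> pq _; rewrite mxE.
  apply: (@Ck_lin _ _ k setT _
    (fun pq : 'M[R]_(n + m) * 'M[R]_(n + m) => pq.1 i j)) => //.
    move=> pq; apply: (@continuous_comp _ _ _ fst (fun M : 'M[R]_(n + m) => M i j)).
      exact: cvg_fst.
    exact: matrix_normedtype.coord_continuous.
  by move=> x v; apply: is_derive_linear => h y w; rewrite /= !mxE.
apply: (@Ck_ext _ _ k setT (fun pq : 'M[R]_(n + m) * 'M[R]_(n + m) => pq.2 i j)) => //.
  by move=> pq _; rewrite mxE.
apply: (@Ck_lin _ _ k setT _
  (fun pq : 'M[R]_(n + m) * 'M[R]_(n + m) => pq.2 i j)) => //.
  move=> pq; apply: (@continuous_comp _ _ _ snd (fun M : 'M[R]_(n + m) => M i j)).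
    exact: cvg_snd.
  exact: matrix_normedtype.coord_continuous.
by move=> x v; apply: is_derive_linear => h y w; rewrite /= !mxE.
Qed.

Lemma slice_coord_continuous E : continuous (fun pq => slice_coord E (cplx pq)).
Proof.
have oT : open [set: 'M[R]_(n + m) * 'M[R]_(n + m)] by exact: openT.
have S := cplx_smooth.
have Sul : smooth_mx setT (fun pq => ulsubmx (cplx pq)).
  apply: smooth_mx_eq (smooth_mx_sub (lshift m) (lshift m) S) _ => pq.
  by apply/matrixP => i j; rewrite !mxE.
have Sur : smooth_mx setT (fun pq => ursubmx (cplx pq)).
  apply: smooth_mx_eq (smooth_mx_sub (lshift m) (@rshift n m) S) _ => pq.
  by apply/matrixP => i j; rewrite !mxE.
have Sdl : smooth_mx setT (fun pq => dlsubmx (cplx pq)).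
  apply: smooth_mx_eq (smooth_mx_sub (@rshift n m) (lshift m) S) _ => pq.
  by apply/matrixP => i j; rewrite !mxE.
have pos B : 0 < 1 + mean_trace (ursubmx (cplx B) *m (ursubmx (cplx B))^t*).
  by rewrite ltr_pwDl // mean_trace_gram_ge0.
apply: Ck0_continuous => k; apply: CkM => //.
  apply: Ck_mean_trace => //; apply: smooth_mx_mul => //; first exact: smooth_mx_cst.
  by apply: smooth_mx_mul => //; exact: smooth_mx_adj.
apply: CkV => //; first by move=> pq _; rewrite gt_eqF // sqrtr_gt0.
apply: Ck_sqrt => //; apply: CkD => //; first exact: Ck_cst.
by apply: Ck_mean_trace => //; apply: smooth_mx_mul => //; exact: smooth_mx_adj.
Qed.

Definition pair_row (x y : R) : 'rV[R]_2 := \row_j (if j == 0 then x else y).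

Lemma pair_row0 x y : pair_row x y 0 0 = x.
Proof. by rewrite mxE eqxx. Qed.

Lemma pair_row1 x y : pair_row x y 0 1 = y.
Proof. by rewrite mxE. Qed.

Lemma pair_rowE (u : 'rV[R]_2) : pair_row (u 0 0) (u 0 1) = u.
Proof.
apply/rowP => j; rewrite mxE; case: (unliftP 0 j) => [k ->|->]; last by rewrite eqxx.
by rewrite (ord1 k); congr (u _ _); apply: val_inj.
Qed.

(** The coordinates extend to K-invariant continuous functions of the matrix,
    which makes the chart open onto its image. *)
Lemma frame_open (U' : set 'rV[R]_2) : open U' ->
  exists2 W, openD W &
    [set coset (frame (u 0 0) (u 0 1)) | u in U'] = surface `&` W.
Proof.
move=> oU.
pose phi g := pair_row (slice_coord E1 g) (slice_coord E2 g).
have phiK g k : UnUm k -> phi (g *m k) = phi g.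
  by move=> Uk; rewrite /phi !slice_coord_mulK.
have phiF (u : 'rV[R]_2) : phi (frame (u 0 0) (u 0 1)) = u.
  by rewrite /phi coord1_frame coord2_frame pair_rowE.
exists [set p | exists2 g, p = coset g & U' (phi g)].
  exists [set pq | U' (phi (cplx pq))].
    apply: (@open_comp _ _ (fun pq => phi (cplx pq))) => // pq _.
    apply: mx_continuous => i j; rewrite ord1.
    rewrite (_ : (fun y => _) = fun pq =>
      if j == 0 then slice_coord E1 (cplx pq) else slice_coord E2 (cplx pq)).
      by case: (j == 0); exact: slice_coord_continuous.
    by apply/funext => y; rewrite mxE.
  move=> g Ug.
  have gE : cplx (map_mx (@complex.Re R) g, map_mx (@complex.Im R) g) = g.
    by apply/matrixP => i j; rewrite !mxE; case: (g i j).
  split=> [[h /coset_eqP[k Uk gh] Uh]|Hg]; first by rewrite /= gE gh phiK.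
  by exists g; [|move: Hg; rewrite /= gE].
apply/seteqP; split=> [_ [u Uu <-]|p [[x [y pE]] [g pg Uphi]]].
  split; first by exists (u 0 0), (u 0 1).
  by exists (frame (u 0 0) (u 0 1)) => //; rewrite phiF.
exists (pair_row x y); last by rewrite pair_row0 pair_row1.
move: pg; rewrite pE => /coset_eqP[k Uk gE].
have := phiF (pair_row x y); rewrite pair_row0 pair_row1 gE phiK // => <-.
exact: Uphi.
Qed.

Lemma openD_ray W x y : openD W ->
  open [set t : R | W (coset (frame (t * x) (t * y)))].
Proof.
move=> [Op oO WO].
have SF : smooth_mx [set: R^o] (fun t => frame (t * x) (t * y)).
  by apply: frame_smooth => [|k|k]; [exact: openT|exact: Ck_mulr|exact: Ck_mulr].
pose h (t : R^o) := (map_mx (@complex.Re R) (frame (t * x) (t * y)),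
                     map_mx (@complex.Im R) (frame (t * x) (t * y))).
have ch : continuous h.
  have c1 : continuous (fun t : R^o => map_mx (@complex.Re R) (frame (t * x) (t * y))).
    apply: mx_continuous => i j.
    rewrite (_ : (fun t => _) = fun t => Re (frame (t * x) (t * y) i j)).
      by apply: Ck0_continuous => k; have [] := SF i j k.
    by apply/funext => s; rewrite mxE.
  have c2 : continuous (fun t : R^o => map_mx (@complex.Im R) (frame (t * x) (t * y))).
    apply: mx_continuous => i j.
    rewrite (_ : (fun t => _) = fun t => Im (frame (t * x) (t * y) i j)).
      by apply: Ck0_continuous => k; have [] := SF i j k.
    by apply/funext => s; rewrite mxE.
  by move=> t; exact: (cvg_pair (c1 t) (c2 t)).
rewrite (_ : mkset _ = h @^-1` Op); first by apply: open_comp => // t _; apply: ch.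
by apply/seteqP; split=> t /=; rewrite WO //; apply: frame_Unm.
Qed.

Lemma frame0 : frame 0 0 = 1%:M.
Proof.
have Z0 : plane 0 0 = 0 by rewrite /plane rmorph0 !scale0r addr0.
have r1 : rho 0 0 = 1 :> R by rewrite /rho expr0n /= !addr0 sqrtr1.
by rewrite /frame Z0 r1 ctmx0 mul0mx scaler0 addr0 rmorph1 -scalar_mx_block.
Qed.

(** Each point is joined to the origin by a ray in the plane. *)
Lemma surface_connected : connectedD surface.
Proof.
have half W1 W2 : openD W1 -> openD W2 -> surface `<=` W1 `|` W2 ->
    surface `&` (W1 `&` W2) = set0 -> W1 (coset 1%:M) -> surface `<=` W1.
  move=> o1 o2 S12 S0 W0 _ [x [y ->]].
  pose A1 : set R := [set t | W1 (coset (frame (t * x) (t * y)))].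
  pose A2 : set R := [set t | W2 (coset (frame (t * x) (t * y)))].
  have inS t : surface (coset (frame (t * x) (t * y))) by do 2 eexists.
  have A12 : A1 = ~` A2.
    apply/seteqP; split=> t /=.
      move=> w1 w2; have : (surface `&` (W1 `&` W2)) (coset (frame (t * x) (t * y))).
        by split.
      by rewrite S0.
    by move=> nw2; have [] := S12 _ (inS t).
  have cR : connected [set: R] by apply/connected_intervalP => a b _ _ c _.
  have A1T : A1 = setT.
    apply: cR.
    - by exists 0; rewrite /A1 /= !mul0r frame0.
    - by exists A1; [exact: openD_ray|rewrite setTI].
    - exists A1; last by rewrite setTI.
      by rewrite A12; apply: open_closedC; exact: openD_ray.
  have : A1 1 by rewrite A1T.
  by rewrite /A1 /= !mul1r.
move=> W1 W2 o1 o2 S12 S0.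
have [] : W1 (coset 1%:M) \/ W2 (coset 1%:M).
- by apply: S12; exists 0, 0; rewrite frame0.
- by left; apply: (half W1 W2).
- right; apply: (half W2 W1) => //; first by rewrite setUC.
  by rewrite (setIC W2).
Qed.

Lemma surface_submanifold : submanifold 2 surface.
Proof.
split.
- by move=> _ [x [y ->]]; exists (frame x y) => //; exact: frame_Unm.
- by exists (coset (frame 0 0)), 0, 0.
- exact: surface_connected.
move=> p [x [y pE]]; exists setT, (fun u => frame (u 0 0) (u 0 1)); split; last first.
  by exists (pair_row x y); [exact: I|rewrite pair_row0 pair_row1].
have Dc j u v : is_derive u v (fun u : 'rV[R]_2 => u 0 j : R^o) (v 0 j).
  by apply: is_derive_linear => h z w; rewrite !mxE.
have Cc j k : Ck k [set: 'rV[R]_2] (fun u => u 0 j : R^o).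
  apply: (@Ck_lin _ _ _ _ _ (fun v : 'rV[R]_2 => v 0 j)) => //; first exact: openT.
  exact: matrix_normedtype.coord_continuous.
split.
- split; [exact: openT|apply: frame_smooth => //; exact: openT|].
  by move=> u _; exact: frame_Unm.
- move=> u v _; apply: contra => /eqP /(frame_immersion (Dc 0 u v) (Dc 1 u v)) [v0 v1].
  by rewrite -[v]pair_rowE v0 v1; apply/eqP/rowP => j; rewrite !mxE; case: ifP.
- move=> u v _ _ /frame_inj [u0 u1].
  by rewrite -[u]pair_rowE u0 u1 pair_rowE.
- by move=> U' oU _; exact: frame_open.
Qed.

Lemma surface_geodesics g A c : Unm g -> tangent surface g A ->
  geodesic_lift A c -> c 0 = g -> forall t, surface (coset (c t)).
Proof.
move=> Ug TA Lc c0.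
have [w1 [w2 [p1 [p2 [cW PA]]]]] := tangent_surface Ug TA.
exact: geodesic_in_surface Ug Lc c0 cW PA.
Qed.

Lemma surface_complete : complete_totally_geodesic 2 surface.
Proof.
split; first exact: surface_submanifold.
  move=> g A c Ug _ TA Lc c0; exists 1 => // t _.
  exact: surface_geodesics Ug TA Lc c0 t.
move=> A c e e0 Lc Sc t; have [Uc Sm Dc] := Lc.
have oU := @open_interval0 R e.
apply: (surface_geodesics (Uc 0) _ Lc (erefl _) t).
exists e, c; split.
- exact: e0.
- by apply: smooth_mx_subset Sm.
- by move=> s se; split; [exact: Uc|exact: Sc].
- by [].
- rewrite /velocity Dc mulKmx; last by have [] := Uc 0.
  by rewrite /hat block_mxKdl.
Qed.

Lemma surface_tangent A : tangent surface 1%:M A <-> exists x y, A = plane x y.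
Proof.
split.
  move=> /(tangent_surface (Unm1 R n m)) [w1 [w2 [p1 [p2 []]]]].
  rewrite [1%:M]scalar_mx_block block_mxKdl block_mxKul block_mxKdr block_mxKur.
  by rewrite mulmx1 mulmx0 subr0 mul1mx mulmx1 => _ ->; exists p1, p2.
move=> [x [y ->]].
have Dl (c : R) : is_derive (0 : R^o) (1 : R^o) (fun t => t * c : R^o) c.
  have := is_deriveM (is_derive_id (0 : R^o) (1 : R^o))
    (is_derive_cst (c : R^o) (0 : R^o) 1).
  by move=> H; apply: is_derive_ext H _ _ => //; rewrite scaler0 add0r; apply: mulr1.
have SF : smooth_mx [set: R^o] (fun t => frame (t * x) (t * y)).
  by apply: frame_smooth => [|k|k]; [exact: openT|exact: Ck_mulr|exact: Ck_mulr].
exists 1, (fun t : R^o => frame (t * x) (t * y)); split.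
- exact: ltr01.
- exact: smooth_mx_subset SF.
- by move=> t _; split; [exact: frame_Unm|do 2 eexists].
- by rewrite !mul0r frame0.
- rewrite (frame_velocity (Dl x) (Dl y)) !mul0r.
  have -> : plane 0 0 = 0 by rewrite /plane rmorph0 !scale0r addr0.
  by rewrite scaler0 addr0.
Qed.

End Model.

(** * The criterion *)

Section Assembly.
Variables (R : realType) (n m : nat).
Local Notation C := R[i].
Local Notation mat := 'M[C]_(n + m).

Lemma real_span2 (V : lmodType C) (u v w : V) :
  real_span [:: u; v] w <-> exists x y : R, w = x%:C *: u + y%:C *: v.
Proof.
split=> [[a ->]|[x [y ->]]].
  by exists (a ord0), (a (lift ord0 ord0)); rewrite big_ord_recl big_ord1.
exists (fun i : 'I_2 => if i == ord0 then x else y).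
by rewrite big_ord_recl big_ord1.
Qed.

(** Otherwise both members of a basis of the plane would be real multiples of
    one vector. *)
Lemma real_span2_free (V : lmodType C) (u v : V) (x y : R) :
  has_real_dim 2 (real_span [:: u; v]) -> x%:C *: u + y%:C *: v = 0 ->
  x = 0 /\ y = 0.
Proof.
move=> [s [s2 fs Es]] uv0.
have no_line (w : V) : (forall z, real_span [:: u; v] z -> exists c : R, z = c%:C *: w) ->
    False.
  case: s s2 fs Es => [|s0 [|s1 [|//]]] // _ fs Es line.
  have free2 (a b : R) : a%:C *: s0 + b%:C *: s1 = 0 -> a = 0 /\ b = 0.
    move=> ab0; pose f (i : 'I_2) := if i == ord0 then a else b.
    have f0 : forall i, f i = 0 by apply: fs; rewrite big_ord_recl big_ord1.
    by split; [exact: (f0 ord0)|exact: (f0 (lift ord0 ord0))].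
  have [p pE] : exists c : R, s0 = c%:C *: w.
    apply: line; rewrite Es; apply/real_span2; exists 1, 0.
    by rewrite rmorph1 rmorph0 scale1r scale0r addr0.
  have [q qE] : exists c : R, s1 = c%:C *: w.
    apply: line; rewrite Es; apply/real_span2; exists 0, 1.
    by rewrite rmorph1 rmorph0 scale1r scale0r add0r.
  have [_ p0] : q = 0 /\ - p = 0.
    apply: free2; rewrite pE qE !scalerA -!rmorphM /= -scalerDl -rmorphD mulNr.
    by rewrite mulrC subrr rmorph0 scale0r.
  have [/eqP] : 1 = 0 :> R /\ 0 = 0 :> R.
    apply: free2; rewrite rmorph0 scale0r addr0 pE (_ : p = 0).
      by rewrite rmorph0 scale0r scaler0.
    by rewrite -[p]opprK p0 oppr0.
  by rewrite oner_eq0.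
have [y0|y0] := eqVneq y 0; last first.
  exfalso; apply: (no_line u) => z /real_span2 [a [b ->]].
  exists (a - b * (x / y)).
  have -> : v = - (x / y)%:C *: u.
    have yC : y%:C != 0 by rewrite fmorph_eq0.
    apply: (scalerI yC); rewrite scalerA mulrN -rmorphM mulrC divfK // scaleNr.
    by apply/eqP; rewrite -addr_eq0 addrC uv0.
  by rewrite scalerA mulrN -rmorphM -scalerDl rmorphB.
have [x0|x0] := eqVneq x 0; first by rewrite x0 y0.
exfalso; apply: (no_line v) => z /real_span2 [a [b ->]]; exists b.
have -> : u = 0.
  have xC : x%:C != 0 by rewrite fmorph_eq0.
  by apply: (scalerI xC); rewrite scaler0 -[RHS]uv0 y0 rmorph0 scale0r addr0.
by rewrite scaler0 add0r.
Qed.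

Lemma hat_comb (X Y : 'M[C]_(m, n)) (x y : R) :
  hat (x%:C *: X + y%:C *: Y) = x%:C *: hat X + y%:C *: hat Y.
Proof.
rewrite /hat !scale_block_mx add_block_mx !scaler0 !addr0.
by rewrite ctmxD !ctmxZ !conjCr.
Qed.

Lemma hat_inj : injective (@hat R n m).
Proof. by move=> A B /eq_block_mx[]. Qed.

Lemma hat_image (T : set 'M[C]_(m, n)) (X Y : 'M[C]_(m, n)) :
  [set hat A | A in T] = real_span [:: hat X; hat Y] <->
  forall A, T A <-> exists x y : R, A = x%:C *: X + y%:C *: Y.
Proof.
split=> [E A|TE].
  have : [set hat A | A in T] (hat A) <-> real_span [:: hat X; hat Y] (hat A).
    by rewrite E.
  rewrite real_span2 => -[H1 H2]; split=> [TA|[x [y AE]]].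
    have [|x [y xy]] := H1; first by exists A.
    by exists x, y; apply: hat_inj; rewrite hat_comb.
  have [|B TB /hat_inj <-//] := H2.
  by exists x, y; rewrite AE hat_comb.
apply/seteqP; split=> [_ [A /TE [x [y ->]] <-]|B /real_span2 [x [y ->]]].
  by apply/real_span2; exists x, y; rewrite hat_comb.
by exists (x%:C *: X + y%:C *: Y); [apply/TE; exists x, y|rewrite hat_comb].
Qed.

(** The surface through the origin is itself one of its translates. *)
Lemma plane_gives_rise (X Y E1 E2 : 'M[C]_(m, n)) (kap : R) : (0 < n)%N ->
  E1^t* *m E1 = 1%:M -> E2^t* *m E2 = 1%:M -> E1^t* *m E2 = (Complex 0 kap)%:M ->
  kap = 0 \/ E2 = Complex 0 1 *: E1 ->
  (forall A, (exists x y, A = plane E1 E2 x y) <->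
             exists x y : R, A = x%:C *: X + y%:C *: Y) ->
  exists S, gives_rise_to 2 (real_span [:: hat X; hat Y]) S.
Proof.
move=> n0 E11 E22 E12 Ekap EV.
exists (translate 1%:M (surface E1 E2)), (surface E1 E2), 1%:M; split=> //.
- exact: (surface_complete n0 E11 E22 E12 Ekap).
- by exists 0, 0; rewrite frame0.
- apply/hat_image => A; rewrite -EV.
  exact: (surface_tangent n0 E11 E22 E12).
- exact: Unm1.
Qed.

Section Data.
Variables (X Y : 'M[C]_(m, n)) (mu : C) (l : R).
Hypothesis l0 : 0 < l.
Hypothesis n0 : (0 < n)%N.
Hypothesis XX : X^t* *m X = (l ^+ 2)%:C%:M.
Hypothesis XY : X^t* *m Y = mu%:M.
Hypothesis XYfree : forall x y : R, x%:C *: X + y%:C *: Y = 0 -> x = 0 /\ y = 0.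

Let r : R := Re mu / l ^+ 2.
Let Y' : 'M[C]_(m, n) := Y - r%:C *: X.

Lemma shifted_gram : X^t* *m Y' = (Complex 0 (Im mu))%:M.
Proof.
rewrite /Y' mulmxBr -scalemxAr XX XY scale_scalar_mx -raddfB /=; congr (_%:M).
apply: eq_ReIm; rewrite !(cReD, cImD, cReN, cImN, cReM, cImM, cReC, cImC, cReE, cImE).
  by rewrite /r; field; rewrite gt_eqF.
by ring.
Qed.

Lemma shifted_span (A : 'M[C]_(m, n)) :
  (exists x y : R, A = x%:C *: X + y%:C *: Y) <->
  (exists x y : R, A = x%:C *: X + y%:C *: Y').
Proof.
split=> -[x [y ->]].
  exists (x + y * r), y; rewrite rmorphD rmorphM /= scalerDl /Y' scalerBr scalerA.
  by rewrite -addrA [_ + (_ - _)]addrCA subrr addr0.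
exists (x - y * r), y; rewrite rmorphB rmorphM /= scalerBl /Y' scalerBr scalerA.
by rewrite -addrA [- _ + _]addrC.
Qed.

Lemma necessary S : gives_rise_to 2 (real_span [:: hat X; hat Y]) S ->
  (Im mu <> 0 /\ real_span [:: X; Y] (Complex 0 1 *: X)) \/
  (Im mu = 0 /\ Umn Y).
Proof.
move=> [S0 [h [[_ tg gc] _ TS _ _]]].
have cg := contains_geodesicsP tg gc.
have TE A : tangent S0 1%:M A <-> exists x y : R, A = x%:C *: X + y%:C *: Y'.
  by apply: iff_trans ((hat_image _ _ _).1 TS A) (shifted_span A).
have [im0|im0] := eqVneq (Im mu) 0.
  right; split; first exact: im0.
  have Y'0 : Y' != 0.
    apply/eqP => Y'0; have [_ /eqP] : - r = 0 /\ 1 = 0 :> R.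
      apply: XYfree; rewrite rmorphN rmorph1 scaleNr scale1r addrC.
      exact: Y'0.
    by rewrite oner_eq0.
  have XY'0 : X^t* *m Y' = 0.
    by rewrite shifted_gram im0 (_ : Complex 0 0 = 0) // raddf0.
  have [k k0 kE] := necessary_real cg TE l0 XX Y'0 XY'0.
  exists (k ^+ 2 + r ^+ 2 * l ^+ 2)%:C.
    by rewrite fmorph_eq0 gt_eqF // -exprMn ltr_pwDl ?sqr_ge0 ?exprn_even_gt0.
  have -> : Y = Y' + r%:C *: X by rewrite /Y' subrK.
  have Y'X : Y'^t* *m X = 0 by rewrite -[X]trmxCK -ctmxM XY'0 ctmx0.
  move: (Y') kE XY'0 Y'X => Z kE XY'0 Y'X.
  rewrite ctmxD ctmxZ conjCr mulmxDl !mulmxDr -!scalemxAr -!scalemxAl kE XY'0 Y'X XX.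
  rewrite !scaler0 addr0 add0r scalerA scale_scalar_mx -raddfD /=; congr (_%:M).
  by rewrite -!rmorphM -rmorphD; congr (_%:C); ring.
left; split; first exact/eqP.
have [x [y xy]] := necessary_complex cg TE l0 XX im0 shifted_gram.
by apply/real_span2; apply/shifted_span; exists x, y.
Qed.

Lemma sufficient_complex : real_span [:: X; Y] (Complex 0 1 *: X) ->
  exists S, gives_rise_to 2 (real_span [:: hat X; hat Y]) S.
Proof.
move=> /real_span2 [a [b iX]].
have ln0 : l != 0 by rewrite gt_eqF.
have b0 : b != 0.
  apply/eqP => b0; move: iX; rewrite b0 scale0r addr0 => /eqP.
  rewrite -subr_eq0 -scalerBl => /eqP /(congr1 (mulmx (X^t*))).
  rewrite mulmx0 -scalemxAr XX scale_scalar_mx -(raddf0 (@scalar_mx C n)).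
  move=> /(scalar_mx_injn n0) /eqP.
  rewrite mulf_eq0 fmorph_eq0 expf_eq0 (negbTE ln0) orbF.
  move=> /eqP /(congr1 (@complex.Im R)) /eqP.
  by rewrite cImD cImN cImC oppr0 addr0 oner_eq0.
have YE : Y = (b^-1)%:C *: (Complex 0 1 *: X) - (a / b)%:C *: X.
  rewrite iX scalerDr !scalerA -!rmorphM /= mulVf // rmorph1 scale1r (mulrC a).
  by rewrite addrC addKr.
pose E1 := (l^-1)%:C *: X.
have E11 : E1^t* *m E1 = 1%:M.
  rewrite /E1 ctmxZ conjCr -scalemxAl -scalemxAr XX !scale_scalar_mx -!rmorphM /=.
  by rewrite mulrA -expr2 -exprMn mulVf // expr1n.
have ii : (Complex 0 1 : C)^* * Complex 0 1 = 1.
  by apply: eq_ReIm; rewrite !(cReM, cImM, cReJ, cImJ, cReE, cImE) /=; ring.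
have e1 (x y : R) : plane E1 (Complex 0 1 *: E1) x y =
    (x / l)%:C *: X + (y / l)%:C *: (Complex 0 1 *: X).
  rewrite /plane /E1 [Complex 0 1 *: (_ *: X)]scalerA mulrC -scalerA !scalerA.
  by rewrite -!rmorphM.
apply: (@plane_gives_rise _ _ E1 (Complex 0 1 *: E1) 1) => //.
- by rewrite ctmxZ -scalemxAl -scalemxAr E11 !scalerA ii scale1r.
- by rewrite -scalemxAr E11 scalemx1.
- by right.
move: iX YE e1; move: (Complex 0 1 *: X) (plane E1 (Complex 0 1 *: E1)) => J P iX YE e1 A.
split=> -[x [y ->]].
  exists (x / l + y / l * a), (y / l * b); rewrite e1 iX scalerDr !scalerA.
  by rewrite addrA rmorphD !rmorphM /= scalerDl.
exists ((x - y * (a / b)) * l), ((y / b) * l); rewrite e1 !mulfK //.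
rewrite YE scalerBr !scalerA -!rmorphM /= rmorphB /= scalerBl.
move: (x%:C *: X) ((y / b)%:C *: J) ((y * (a / b))%:C *: X) => U1 U2 U3.
by rewrite addrA addrAC.
Qed.

Lemma sufficient_real : Im mu = 0 -> Umn Y ->
  exists S, gives_rise_to 2 (real_span [:: hat X; hat Y]) S.
Proof.
move=> im0 [z z0 YY].
have ln0 : l != 0 by rewrite gt_eqF.
have XY'0 : X^t* *m Y' = 0.
  by rewrite shifted_gram im0 (_ : Complex 0 0 = 0) // raddf0.
have Y'X : Y'^t* *m X = 0 by rewrite -[X]trmxCK -ctmxM XY'0 ctmx0.
have Y'0 : Y' != 0.
  apply/eqP => Y'0; have [_ /eqP] : - r = 0 /\ 1 = 0 :> R.
    apply: XYfree; rewrite rmorphN rmorph1 scaleNr scale1r addrC.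
    exact: Y'0.
  by rewrite oner_eq0.
have YE : Y = Y' + r%:C *: X by rewrite /Y' subrK.
have SP := shifted_span.
move: (Y') XY'0 Y'X Y'0 YE SP => Z XZ ZX Z0 YE SP.
pose w := z - (r ^+ 2 * l ^+ 2)%:C.
have ZZ : Z^t* *m Z = w%:M.
  have := YY; rewrite YE ctmxD ctmxZ conjCr mulmxDl !mulmxDr -!scalemxAr -!scalemxAl.
  rewrite XZ ZX XX !scaler0 addr0 add0r scalerA scale_scalar_mx -!rmorphM /=.
  move=> /(canRL (addrK _)) ->; rewrite -raddfB /= /w.
  by congr ((_ - _%:C)%:M); ring.
pose j0 := Ordinal n0.
have := ctmx_mul_diag_ge0 Z j0; rewrite ZZ mxE eqxx mulr1n lecE => /andP[/eqP wi wr].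
have wE : w = (Re w)%:C by apply: eq_ReIm.
pose k := Num.sqrt (Re w).
have k2 : k ^+ 2 = Re w by rewrite sqr_sqrtr.
have k0 : k != 0.
  apply: contra Z0 => /eqP k0; apply/eqP; apply: ctmx_mul_eq0.
  by rewrite ZZ wE -k2 k0 expr0n /= rmorph0 ?raddf0.
have unit_gram (u : R) (B : 'M[C]_(m, n)) : u != 0 -> B^t* *m B = (u ^+ 2)%:C%:M ->
    ((u^-1)%:C *: B)^t* *m ((u^-1)%:C *: B) = 1%:M.
  move=> u0 BB; rewrite ctmxZ conjCr -scalemxAl -scalemxAr BB.
  rewrite !scale_scalar_mx -!rmorphM /=.
  by rewrite mulrA -expr2 -exprMn mulVf // expr1n.
apply: (@plane_gives_rise _ _ ((l^-1)%:C *: X) ((k^-1)%:C *: Z) 0) => //.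
- exact: unit_gram.
- by apply: unit_gram => //; rewrite ZZ k2 -wE.
- rewrite ctmxZ conjCr -scalemxAl -scalemxAr XZ !scaler0.
  by rewrite (_ : Complex 0 0 = 0) // raddf0.
- by left.
move=> A; rewrite SP /plane; split=> -[x [y ->]].
  by exists (x / l), (y / k); rewrite !scalerA -!rmorphM.
by exists (x * l), (y * k); rewrite !scalerA -!rmorphM /= !mulfK.
Qed.

End Data.
End Assembly.

Theorem theorem3p4 (R : realType) (n m : nat) (X Y : 'M[R[i]]_(m, n))
    (lambda mu : R[i]) (m' : set 'M[R[i]]_(n + m)) :
  Umn X ->
  m' = real_span [:: hat X; hat Y] ->
  has_real_dim 2 m' ->
  X ^t* *m X = lambda%:M ->
  X ^t* *m Y = mu%:M ->
  (exists S, gives_rise_to 2 m' S) <->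
  ((complex.Im mu <> 0 /\ real_span [:: X; Y] ('i *: X)) \/
   (complex.Im mu = 0 /\ Umn Y)).
Proof.
move=> _ -> dim2 XX XY.
have XYfree (x y : R) : x%:C *: X + y%:C *: Y = 0 -> x = 0 /\ y = 0.
  move=> xy0; apply: (real_span2_free dim2); rewrite -hat_comb xy0.
  by rewrite /hat ctmx0 block_mx0.
have X0 : X != 0.
  apply/eqP => X0; have [/eqP] : 1 = 0 :> R /\ 0 = 0 :> R.
    by apply: XYfree; rewrite X0 scaler0 rmorph0 scale0r addr0.
  by rewrite oner_eq0.
have n0 : (0 < n)%N.
  rewrite lt0n; apply: contra X0 => /eqP n0; apply/eqP/matrixP => i j.
  by have := ltn_ord j; rewrite [X in (_ < X)%N]n0.
pose j0 := Ordinal n0.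
have := ctmx_mul_diag_ge0 X j0; rewrite XX mxE eqxx mulr1n lecE => /andP[/eqP li lr].
have lE : lambda = (Re lambda)%:C by apply: eq_ReIm.
pose l := Num.sqrt (Re lambda).
have l2 : l ^+ 2 = Re lambda by rewrite sqr_sqrtr.
have XX' : X^t* *m X = (l ^+ 2)%:C%:M by rewrite XX lE l2.
have l0 : 0 < l.
  rewrite lt_neqAle sqrtr_ge0 andbT eq_sym; apply: contra X0 => /eqP l0.
  by apply/eqP; apply: ctmx_mul_eq0; rewrite XX' l0 expr0n /= rmorph0 ?raddf0.
split=> [[S GS]|[[_ iX]|[im0 UY]]].
- exact: (necessary l0 XX' XY XYfree GS).
- exact: (sufficient_complex l0 n0 XX' iX).
- exact: (sufficient_real l0 n0 XX' XY XYfree im0 UY).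
Qed.
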